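(* Let $H$ be a group with Kazhdan's property (T) acting by isometric automorphisms on a metric median algebra $(X,d,\mu)$ which is uniformly rectifiable and of finite rank, and such that $(X,d)$ is complete and connected. Then the action has a fixed point.
   Context: A median algebra is a set $M$ with a ternary operation $\mu$ such that $\mu(x,y,z)=\mu(x,z,y)=\mu(y,z,x)$, $\mu(x,x,y)=x$ and $\mu(\mu(x,y,z),u,v)=\mu(x,\mu(y,u,v),\mu(z,u,v))$ for all $x,y,z,u,v$. The median interval is $I(x,y)=\{z:\mu(x,y,z)=z\}$; a subset is convex if it contains $I(a,b)$ for all its elements $a,b$; a subalgebra is a subset closed under $\mu$. A wall is a partition $M=h\sqcup h^c$ into two non-empty convex subsets; it separates $a,b$ if they lie in different parts; $\mathcal{W}(M)$ is the set of walls and $\mathcal{W}^M(a|b)$ the set of walls separating $a,b$. Every finite median algebra $M$ is the vertex set of a finite $\mathrm{CAT}(0)$ cube complex $\mathscr{C}(M)$ whose edges join $x,y$ exactly when a unique wall of $M$ separates them; the rank of a finite median algebra is the dimension of $\mathscr{C}(M)$, and the rank of a general median algebra is the supremum of ranks of its finite subalgebras. A metric median algebra $(X,d,\mu)$ is a median algebra $(X,\mu)$ with a metric $d$ for which $\mu$ is continuous; an isometric automorphism is an isometry of $(X,d)$ commuting with $\mu$. For a finite subalgebra $M$ and $W\in\mathcal{W}(M)$, let $\lambda^M_{\max}(W)=\max d(a,b)$ over edges $\{a,b\}$ of $\mathscr{C}(M)$ separated by $W$; for $x,y\in X$ set $d^M_\mu(x,y)=\sum_{W\in\mathcal{W}^M(x|y)}\lambda^M_{\max}(W)$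 if $x,y\in M$ and $0$ otherwise, and $d_\mu(x,y)=\sup_M d^M_\mu(x,y)\in[0,\infty]$ over all finite subalgebras $M$. $(X,d,\mu)$ is uniformly rectifiable if there is $L\ge0$ with $d_\mu(x,y)\le L\,d(x,y)$ for all $x,y$. *)

(* Defs.v *)
From HB Require Import structures.
From mathcomp Require Import all_boot all_order all_algebra.
From mathcomp Require Import finmap.
From mathcomp Require Import complex.
From mathcomp Require Import boolp classical_sets reals constructive_ereal ereal.
Set Implicit Arguments. Unset Strict Implicit. Unset Printing Implicit Defensive.
Import Order.TTheory GRing.Theory Num.Theory.
Local Open Scope ring_scope.

Definition is_group (G : Type) (mul : G -> G -> G) (one : G) (inv : G -> G) : Prop :=
  [/\ forall a b c, mul a (mul b c) = mul (mul a b) c,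
      forall a, mul one a = a /\ mul a one = a
    & forall a, mul (inv a) a = one /\ mul a (inv a) = one].

Section Hilbert.
Variable R : realType.
Variable V : lmodType R[i].
Variable ip : V -> V -> R[i].

Definition hnorm (v : V) : R := Num.sqrt (complex.Re (ip v v)).

Definition is_hilbert : Prop :=
  [/\ (forall (a : R[i]) (u v w : V), ip (a *: u + v) w = a * ip u w + ip v w),
      (forall u v, ip u v = conjc (ip v u)),
      (forall v, 0 <= ip v v),
      (forall v, ip v v = 0 -> v = 0)
    & (forall u : nat -> V,
         (forall e : R, 0 < e -> exists N, forall m n, (N <= m)%N -> (N <= n)%N ->
             hnorm (u m - u n) < e) ->
         exists l : V, forall e : R, 0 < e -> exists N, forall n, (N <= n)%N ->
             hnorm (u n - l) < e)].

Definition unitary_rep (G : Type) (mul : G -> G -> G) (one : G) (pi : G -> V -> V) : Prop :=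
  [/\ (forall g (a : R[i]) u v, pi g (a *: u + v) = a *: pi g u + pi g v),
      (forall g u v, ip (pi g u) (pi g v) = ip u v),
      (forall v, pi one v = v)
    & (forall g h v, pi (mul g h) v = pi g (pi h v))].

(* almost invariant vectors (G discrete: compact subsets are finite) *)
Definition almost_invariant_vectors (G : Type) (pi : G -> V -> V) : Prop :=
  forall (n : nat) (Q : 'I_n -> G) (e : R), 0 < e ->
    exists v : V, hnorm v = 1 /\ forall i, hnorm (pi (Q i) v - v) < e.

Definition nonzero_invariant_vector (G : Type) (pi : G -> V -> V) : Prop :=
  exists v : V, v <> 0 /\ forall g, pi g v = v.
End Hilbert.

Definition property_T (R : realType) (G : Type) (mul : G -> G -> G) (one : G)
    (inv : G -> G) : Prop :=
  forall (V : lmodType R[i]) (ip : V -> V -> R[i]) (pi : G -> V -> V),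
    is_hilbert ip -> unitary_rep ip mul one pi ->
    almost_invariant_vectors ip pi -> nonzero_invariant_vector pi.

Definition median_algebra (X : Type) (mu : X -> X -> X -> X) : Prop :=
  [/\ forall x y z, mu x y z = mu x z y /\ mu x y z = mu y z x,
      forall x y, mu x x y = x
    & forall x y z u v, mu (mu x y z) u v = mu x (mu y u v) (mu z u v)].

Section Metric.
Variables (R : realType) (X : Type) (d : X -> X -> R).

Definition is_metric : Prop :=
  [/\ forall x y, 0 <= d x y,
      forall x y, d x y = 0 <-> x = y,
      forall x y, d x y = d y x
    & forall x y z, d x z <= d x y + d y z].

Definition metric_open (A : X -> Prop) : Prop :=
  forall a, A a -> exists2 r : R, 0 < r & forall b, d a b < r -> A b.

Definition metric_connected : Prop :=
  (exists x : X, True) /\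
  forall A : X -> Prop, metric_open A -> metric_open (fun x => ~ A x) ->
    (forall x, A x) \/ (forall x, ~ A x).

Definition metric_complete : Prop :=
  forall u : nat -> X,
    (forall e : R, 0 < e -> exists N, forall m n, (N <= m)%N -> (N <= n)%N -> d (u m) (u n) < e) ->
    exists l : X, forall e : R, 0 < e -> exists N, forall n, (N <= n)%N -> d (u n) l < e.

Definition continuous3 (mu : X -> X -> X -> X) : Prop :=
  forall x y z (e : R), 0 < e -> exists2 r : R, 0 < r &
    forall x' y' z', d x x' < r -> d y y' < r -> d z z' < r -> d (mu x y z) (mu x' y' z') < e.

Definition metric_median_algebra (mu : X -> X -> X -> X) : Prop :=
  [/\ median_algebra mu, is_metric & continuous3 mu].
End Metric.

Section Finite.
Variables (R : realType) (X : choiceType) (d : X -> X -> R) (mu : X -> X -> X -> X).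

Definition subalgebra (M : {fset X}) : Prop :=
  forall a b c, a \in M -> b \in M -> c \in M -> mu a b c \in M.

(* h is convex in M: it contains the (M-)median interval I(a,b) of any a,b in h *)
Definition convex_in (M h : {fset X}) : bool :=
  all (fun a => all (fun b => all (fun c => (mu a b c == c) ==> (c \in h)) M) h) h.

(* h is one side of a wall of M (a wall is {h, M \ h}) *)
Definition halfspace (M h : {fset X}) : bool :=
  [&& (h `<=` M)%fset, h != fset0, (M `\` h)%fset != fset0, convex_in M h
    & convex_in M (M `\` h)%fset].

(* the walls of M separating a and b, each represented by its side containing a *)
Definition sep_half (M : {fset X}) (a b : X) : {fset {fset X}} :=
  [fset h in fpowerset M | halfspace M h && (a \in h) && (b \notin h)]%fset.

(* edges of the cube complex C(M): exactly one wall separates a and b *)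
Definition edge (M : {fset X}) (a b : X) : bool :=
  [&& a \in M, b \in M & #|` sep_half M a b|%fset == 1%N].

Definition lambda_max (M h : {fset X}) : R :=
  \big[Num.max/0]_(a <- M) \big[Num.max/0]_(b <- M | edge M a b && (a \in h) && (b \notin h))
     d a b.

Definition dM (M : {fset X}) (x y : X) : R :=
  if (x \in M) && (y \in M) then \sum_(h <- sep_half M x y) lambda_max M h else 0.

Definition d_mu (x y : X) : \bar R :=
  ereal_sup [set (dM M x y)%:E | M in [set M : {fset X} | subalgebra M]].

Definition uniformly_rectifiable : Prop :=
  exists2 L : R, 0 <= L & forall x y, (d_mu x y <= (L * d x y)%:E)%E.

Definition has_cube (M : {fset X}) (n : nat) : Prop :=
  exists f : {ffun 'I_n -> bool} -> X,
    [/\ injective f, forall v, f v \in M &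
        forall v w : {ffun 'I_n -> bool}, #|[set i | v i != w i]| = 1%N -> edge M (f v) (f w)].

(* rank(M) = dim C(M); rank(X) = sup of ranks of finite subalgebras *)
Definition finite_rank : Prop :=
  exists N : nat, forall M n, subalgebra M -> has_cube M n -> (n <= N)%N.
End Finite.

Definition isometric_action (R : realType) (G X : Type) (mul : G -> G -> G) (one : G)
    (d : X -> X -> R) (mu : X -> X -> X -> X) (act : G -> X -> X) : Prop :=
  [/\ forall x, act one x = x,
      forall g h x, act (mul g h) x = act g (act h x),
      forall g x y, d (act g x) (act g y) = d x y
    & forall g x y z, act g (mu x y z) = mu (act g x) (act g y) (act g z)].

(* Main.v *)
Require Import Defs.
From HB Require Import structures.
From mathcomp Require Import all_boot all_order all_algebra.
From mathcomp Require Import finmap complex.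
From mathcomp Require Import boolp classical_sets reals constructive_ereal ereal.
From mathcomp Require Import functions topology normedtype sequences exp.
From mathcomp Require Import ring lra.

(** The supremum [delta] of the metrics [dM] over finite subalgebras is a median
    metric, invariant under the action and bi-Lipschitz to [d]: [dM] is additive on
    intervals, dominates [d] and grows with [M].

    Bounded orbits. Each [exp (- t delta)] is a positive definite kernel, being a
    limit of products of two-valued kernels, one for each wall. Property (T),
    applied to the direct sum of the reproducing kernel Hilbert spaces of
    [exp (- delta / n)], yields a nonzero invariant function of finite norm; on an
    unbounded orbit such a function would have infinite norm.

    Fixed point. Let [dinf x y] be the supremum of [f y - f x] over the 1-Lipschitz
    functions [f] that are monotone on intervals. Balls of [dinf] are convex. Since
    at most [rank] walls are pairwise transverse, a heavy chain of walls (and an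
    ultralimit over finite subalgebras) shows [delta <= rank * dinf]. Connectedness
    and the Helly property make [dinf] hyperconvex up to arbitrarily small errors.
    As in Lang's fixed point theorem for injective spaces, the circumradius function
    of an orbit is then improved to almost extremal invariant functions, whose
    almost centers converge to a fixed point. *)

Set Implicit Arguments.
Unset Strict Implicit.
Unset Printing Implicit Defensive.
Import Order.TTheory GRing.Theory Num.Theory numFieldNormedType.Exports.
Local Open Scope ring_scope.

(** * Median algebras *)

(** The metric [d] need not be additive along intervals, so it is not a sum over walls and gives no
    positive definite kernel; [delta] repairs this, and the bi-Lipschitz bound carries completeness
    and continuity over to it. No single kernel [exp (- delta / n)] need have almost invariant
    vectors: they appear only as [n] grows, which is why all levels are summed. The invariant
    function is nonzero at some level, and there transitivity of the group on itself makes it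
    constant. A bounded orbit does not yield a fixed point directly: [delta] is a metric of l1 type,
    whose balls are in general not convex. The metric [dinf] is of l-infinity type, so its balls
    fall under Helly's theorem, and finite rank makes the two metrics comparable. Helly's theorem
    covers only finite families and no compactness is assumed, so infinite families are treated
    through completeness, by means of nearly nearest points. *)

Section MedianAlgebra.
Variables (X : choiceType) (mu : X -> X -> X -> X).
Hypothesis mu_median : median_algebra mu.

Lemma medAC x y z : mu x y z = mu x z y.
Proof. by case: mu_median => C _ _; case: (C x y z). Qed.

Lemma medR x y z : mu x y z = mu y z x.
Proof. by case: mu_median => C _ _; case: (C x y z). Qed.

Lemma medCA x y z : mu x y z = mu y x z.
Proof. by rewrite medR medAC. Qed.

Lemma medxx x y : mu x x y = x.
Proof. by case: mu_median. Qed.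

Lemma medyy x y : mu y x x = x.
Proof. by rewrite medR medxx. Qed.

Lemma medxyx x y : mu x y x = x.
Proof. by rewrite medAC medxx. Qed.

Lemma medD x y z u v : mu (mu x y z) u v = mu x (mu y u v) (mu z u v).
Proof. by case: mu_median. Qed.

Lemma medRR x y z : mu x y z = mu z x y.
Proof. by rewrite medR medR. Qed.

Lemma med_idem x y z : mu x y (mu x y z) = mu x y z.
Proof. by rewrite (medRR x y (mu _ _ _)) (medRR x y z) medD medxx medxyx. Qed.

Lemma med_retract x y a b c :
  mu x y (mu a b c) = mu (mu x y a) (mu x y b) (mu x y c).
Proof.
rewrite -med_idem (medRR x y (mu a b c)) medD -!(medRR x y).
by rewrite (medRR x y (mu a _ _)) (medCA a) medD -!(medRR x y) med_idem medCA.
Qed.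

(* [mu p] is a semilattice operation over which the median distributes, so the
   finite meets of elements of M, together with p, form a finite subalgebra. *)
Inductive meets (p : X) (M : {fset X}) : X -> Prop :=
| meets_base a : a \in M -> meets p M a
| meets_step a b : meets p M a -> meets p M b -> meets p M (mu p a b).

Lemma meets_med p M a b c : subalgebra mu M ->
  meets p M a -> meets p M b -> meets p M c -> meets p M (mu a b c).
Proof.
move=> sM Ma; elim: Ma b c => {a} [a aM|a a' _ IHa _ IHa'] b c Mb Mc; last first.
  by rewrite medD; apply: meets_step; [exact: IHa|exact: IHa'].
elim: Mb c Mc => {b} [b bM|b b' _ IHb _ IHb'] c Mc; last first.
  rewrite medCA medD; apply: meets_step; rewrite medCA;
  [exact: IHb|exact: IHb'].
elim: Mc => {c} [c cM|c c' _ IHc _ IHc']; first by apply: meets_base; apply: sM.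
rewrite (medRR a) medD -!(medRR a).
by apply: meets_step; [exact: IHc|exact: IHc'].
Qed.

Lemma meetsA p a b c : mu p (mu p a b) c = mu p a (mu p b c).
Proof. by rewrite (medCA p a b) (medCA p) medD medxx (medCA b) medCA. Qed.

Lemma finite_meet_closure p (M : {fset X}) : exists T : {fset X},
  [/\ {subset M <= T}, forall t, t \in T -> meets p M t &
      forall s t, s \in T -> t \in T -> mu p s t \in T].
Proof.
suff [T [MT Tm TT]] : exists T : {fset X}, [/\ {subset (enum_fset M) <= T},
   forall t, t \in T -> meets p M t & forall s t, s \in T -> t \in T -> mu p s t \in T].
  by exists T.
have : {subset enum_fset M <= M} by [].
elim: (enum_fset M) => [_|a s IH sM].
  by exists fset0.
have [|T [MT Tm TT]] := IH; first by move=> x xs; apply: sM; rewrite inE xs orbT.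
have aM : a \in M by apply: sM; rewrite inE eqxx.
(* As [mu p] is associative, commutative and idempotent, a closed [T] stays closed once [a] and the
   meets of [a] with [T] are added. *)
exists (a |` (T `|` [fset mu p a t | t in T]))%fset.
have step t : t \in T -> mu p a t \in [fset mu p a t | t in T]%fset.
  by move=> tT; apply/imfsetP; exists t.
split.
- by move=> x; rewrite !inE => /orP[->//|/MT ->]; rewrite orbT.
- move=> t; rewrite !inE => /or3P[/eqP->|/Tm//|/imfsetP[u /= uT ->]].
    exact: meets_base.
  by apply: meets_step; [exact: meets_base|exact: Tm].
- have E t u : mu p (mu p a t) (mu p a u) = mu p a (mu p t u).
    by rewrite meetsA -(meetsA _ t) (medAC p t) meetsA -meetsA medyy.
  move=> s' t; rewrite !inE => /or3P[/eqP->|s'T|/imfsetP[u /= uT ->]]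
     /or3P[/eqP->|tT|/imfsetP[v /= vT ->]].
  + by rewrite medyy eqxx.
  + by rewrite step // !orbT.
  + by rewrite -meetsA medyy step ?orbT.
  + by rewrite medAC step ?orbT.
  + by rewrite TT ?orbT.
  + by rewrite medAC meetsA step ?orbT //; apply: TT.
  + by rewrite medAC -meetsA medyy step ?orbT.
  + by rewrite meetsA step ?orbT //; apply: TT.
  + by rewrite E step ?orbT //; apply: TT.
Qed.

Lemma subalgebra_adjoin p (M : {fset X}) : subalgebra mu M ->
  exists M' : {fset X}, [/\ subalgebra mu M', {subset M <= M'} & p \in M'].
Proof.
move=> sM; have [T [MT Tm TT]] := finite_meet_closure p M.
have mT t : meets p M t -> t \in T.
  by elim=> [a /MT //|a b _ aT _ bT]; apply: TT.
exists (p |` T)%fset; split; last by rewrite !inE eqxx.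
  move=> a b c; rewrite !inE => /orP[/eqP->|aT] /orP[/eqP->|bT] /orP[/eqP->|cT];
    rewrite ?medxx ?medyy ?medxyx ?eqxx //.
  - by rewrite TT ?orbT.
  - by rewrite medCA TT ?orbT.
  - by rewrite -medR TT ?orbT.
  - by rewrite mT ?orbT //; apply: meets_med => //; apply: Tm.
by move=> x xM; rewrite !inE MT ?orbT.
Qed.

Lemma subalgebra_ext (s : seq X) (M : {fset X}) : subalgebra mu M ->
  exists M' : {fset X}, [/\ subalgebra mu M', {subset M <= M'} & {subset s <= M'}].
Proof.
move=> sM; elim: s => [|p s [M1 [sM1 MM1 s1]]]; first by exists M; split.
have [M' [sM' M1M' pM']] := subalgebra_adjoin p sM1.
exists M'; split=> // x; first by move/MM1/M1M'.
by rewrite inE => /orP[/eqP->//|/s1/M1M'].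
Qed.

Lemma subalgebra_directed (M1 M2 : {fset X}) : subalgebra mu M1 ->
  exists M' : {fset X}, [/\ subalgebra mu M', {subset M1 <= M'} & {subset M2 <= M'}].
Proof. exact: subalgebra_ext. Qed.

Lemma subalgebra_gen (s : seq X) :
  exists M : {fset X}, subalgebra mu M /\ {subset s <= M}.
Proof.
have [|M [sM _ ?]] := @subalgebra_ext s fset0; first by move=> a b c.
by exists M.
Qed.

(** Since [mu a b] retracts onto the interval of [a] and [b], this is the usual convexity for
    subsets of a [U] closed under the median. The ambient [U] is a finite subalgebra for walls and
    all of [X] in the metric part. *)
Definition mconvex (U A : X -> Prop) : Prop :=
  forall a b c, A a -> A b -> U c -> A (mu a b c).

(* Helly's theorem; the three-set case is the median of the pairwise points. *)
Lemma helly (U : X -> Prop) n (A : 'I_n.+1 -> X -> Prop) :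
  (forall i x, A i x -> U x) -> (forall i, mconvex U (A i)) ->
  (forall i j, exists x, A i x /\ A j x) -> exists x, forall i, A i x.
Proof.
elim: n A => [|n IH] A AU cA meet.
  by have [x [Ax _]] := meet ord0 ord0; exists x => i; rewrite ord1.
pose B (i : 'I_n.+1) x := A ord0 x /\ A (lift ord0 i) x.
have [||i j|x Bx] := IH B.
- by move=> i x [] /AU.
- by move=> i a b c [? ?] [? ?] Uc; split; apply: cA.
- have [a [a0 ai]] := meet ord0 (lift ord0 i).
  have [b [b0 bj]] := meet ord0 (lift ord0 j).
  have [c [ci cj]] := meet (lift ord0 i) (lift ord0 j).
  exists (mu a b c); have [[Ua Ub] Uc] := (AU _ _ a0, AU _ _ b0, AU _ _ ci).
  rewrite /B; do 2!split; try exact: cA.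
  + by rewrite medAC; apply: cA.
  + by rewrite medR; apply: cA.
- exists x => i; case: (unliftP ord0 i) => [j|] ->; first by case: (Bx j).
  by case: (Bx ord0).
Qed.

End MedianAlgebra.

(** * Walls of finite subalgebras *)

Section Walls.
Variables (R : realType) (X : choiceType) (d : X -> X -> R) (mu : X -> X -> X -> X).
Hypotheses (mu_median : median_algebra mu) (d_metric : is_metric d).
Implicit Types (M h : {fset X}) (a b c x y z : X).

Lemma ler_sum_fsubset (K : choiceType) (A B : {fset K}) (F : K -> R) :
  (A `<=` B)%fset -> (forall i, i \in B -> 0 <= F i) ->
  \sum_(i <- A) F i <= \sum_(i <- B) F i.
Proof.
move=> AB F0; rewrite [leRHS](big_fsetID _ (mem A)) /=.
have -> : [fset i in B | i \in A]%fset = A.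
  apply/fsetP=> i; rewrite !inE andbC.
  by case: (boolP (i \in A)) => //= /(fsubsetP AB).
by rewrite lerDl big_seq; apply: sumr_ge0 => i; rewrite !inE => /andP[/F0].
Qed.

Lemma sep_halfE M a b h :
  (h \in sep_half mu M a b) = [&& halfspace mu M h, a \in h & b \notin h].
Proof.
rewrite !inE /= fpowersetE; apply/andP/and3P => [[hM /andP[/andP[]]]//|[hh -> ->]].
by rewrite hh; case/and5P: hh.
Qed.

Lemma halfspace_sub M h : halfspace mu M h -> {subset h <= M}.
Proof. by case/and5P=> /fsubsetP. Qed.

Lemma halfspace_med M h a b c : subalgebra mu M -> halfspace mu M h ->
  a \in h -> b \in h -> c \in M -> mu a b c \in h.
Proof.
move=> sM hh ah bh cM; have hM := halfspace_sub hh; case/and5P: hh => _ _ _.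
move=> /allP/(_ _ ah)/allP/(_ _ bh)/allP/(_ (mu a b c)) + _.
rewrite (med_idem mu_median) eqxx; apply; apply: sM => //; exact: hM.
Qed.

Lemma halfspace_medN M h a b c : subalgebra mu M -> halfspace mu M h ->
  a \in M -> b \in M -> a \notin h -> b \notin h -> c \in M -> mu a b c \notin h.
Proof.
move=> sM hh aM bM ah bh cM; case/and5P: hh => _ _ _ _.
have aD : a \in (M `\` h)%fset by rewrite inE ah.
have bD : b \in (M `\` h)%fset by rewrite inE bh.
move=> /allP/(_ _ aD)/allP/(_ _ bD)/allP/(_ (mu a b c)).
by rewrite (med_idem mu_median) eqxx => /(_ (sM _ _ _ aM bM cM)); rewrite inE => /andP[].
Qed.

Lemma mk_halfspace M h a b : {subset h <= M} -> a \in h -> b \in M -> b \notin h ->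
  (forall u v w, u \in h -> v \in h -> w \in M -> mu u v w = w -> w \in h) ->
  (forall u v w, u \in M -> v \in M -> u \notin h -> v \notin h -> w \in M ->
     mu u v w = w -> w \notin h) ->
  halfspace mu M h.
Proof.
move=> hM ah bM bh ch cN; apply/and5P; split.
- exact/fsubsetP.
- by apply/fset0Pn; exists a.
- by apply/fset0Pn; exists b; rewrite inE bh.
- by do 3!(apply/allP=> ? ?); apply/implyP=> /eqP; apply: ch.
- apply/allP=> u; rewrite inE => /andP[? ?]; apply/allP=> v; rewrite inE => /andP[? ?].
  by apply/allP=> w wM; apply/implyP=> /eqP E; rewrite inE wM (cN u v).
Qed.

Lemma halfspaceC M h : halfspace mu M h -> halfspace mu M (M `\` h)%fset.
Proof.
case/and5P=> hM h0 hc ch chc; apply/and5P; split=> //; first exact: fsubsetDl.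
  by rewrite fsetDK.
by rewrite fsetDK.
Qed.

Lemma sep_halfC M a b h : a \in M -> b \in M -> h \in sep_half mu M a b ->
  (M `\` h)%fset \in sep_half mu M b a.
Proof.
move=> aM bM; rewrite !sep_halfE => /and3P[hh ah bh].
by rewrite halfspaceC // !inE ah bh aM bM.
Qed.

(** Walls of the larger subalgebra leave traces on the smaller one; [dM_mono] compares weights along
    this trace map. *)
Lemma sep_half_restrict M M' a b h : subalgebra mu M -> subalgebra mu M' ->
  {subset M <= M'} -> a \in M -> b \in M ->
  h \in sep_half mu M' a b -> (M `&` h)%fset \in sep_half mu M a b.
Proof.
move=> sM sM' MM' aM bM; rewrite !sep_halfE => /and3P[hh ah bh].
rewrite !inE ah aM bM (negPf bh) /= andbT; apply: (@mk_halfspace _ _ a b) => //.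
- by move=> u; rewrite inE => /andP[].
- by rewrite inE aM.
- by rewrite inE (negPf bh) andbF.
- move=> u v w; rewrite !inE => /andP[uM uh] /andP[vM vh] wM <-.
  by rewrite sM // (halfspace_med sM') // MM'.
- move=> u v w uM vM; rewrite !inE uM vM => /= uh vh wM <-.
  by rewrite sM //= (halfspace_medN sM') // MM'.
Qed.

Lemma sep_half_uniq M a b h h' : edge mu M a b ->
  h \in sep_half mu M a b -> h' \in sep_half mu M a b -> h = h'.
Proof.
case/and3P=> _ _ /cardfs1P[k ->]; rewrite !inE => /eqP-> /eqP->; done.
Qed.

Lemma card_sep_halfC M a b : a \in M -> b \in M ->
  #|` sep_half mu M a b| = #|` sep_half mu M b a|.
Proof.
move=> aM bM; have sub u v : u \in M -> v \in M -> {in sep_half mu M u v, forall h, (h `<=` M)%fset}.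
  by move=> _ _ h; rewrite sep_halfE => /and3P[/and5P[]].
suff le u v : u \in M -> v \in M -> (#|` sep_half mu M u v| <= #|` sep_half mu M v u|)%N.
  by apply/eqP; rewrite eqn_leq !le.
move=> uM vM.
have inj : {in sep_half mu M u v &, injective (fun h => M `\` h)%fset}.
  by move=> h k /(sub _ _ uM vM) hM /(sub _ _ uM vM) kM E; rewrite -(fsetDK hM) E fsetDK.
rewrite -(card_in_imfset imfset_key inj) /=.
apply: fsubset_leq_card; apply/fsubsetP=> k /imfsetP[h /= hs ->].
exact: sep_halfC.
Qed.

Lemma edgeC M a b : edge mu M a b = edge mu M b a.
Proof.
rewrite /edge; case aM: (a \in M); case bM: (b \in M) => //=.
by rewrite card_sep_halfC.
Qed.

Lemma lambda_max_ge M h a b : edge mu M a b -> a \in h -> b \notin h ->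
  d a b <= lambda_max d mu M h.
Proof.
move=> eab ah bh; have/and3P[aM bM _] := eab.
apply: (@bigmax_sup_seq _ _ _ _ _ a) => //; apply: (@bigmax_sup_seq _ _ _ _ _ b) => //.
by rewrite eab ah.
Qed.

Lemma lambda_max_le M h C : 0 <= C ->
  (forall a b, edge mu M a b -> a \in h -> b \notin h -> d a b <= C) ->
  lambda_max d mu M h <= C.
Proof.
move=> C0 dC; apply: bigmax_le => // a _; apply: bigmax_le => // b.
by case/andP=> /andP[]; apply: dC.
Qed.

Lemma lambda_max_ge0 M h : 0 <= lambda_max d mu M h.
Proof.
rewrite /lambda_max; elim/big_ind: _ => // [u v u0 v0|a _]; first by rewrite le_max u0.
by elim/big_ind: _ => // [u v u0 v0|b _]; rewrite ?le_max ?u0 //; case: d_metric.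
Qed.

Lemma lambda_maxC M h : lambda_max d mu M (M `\` h)%fset = lambda_max d mu M h.
Proof.
have dC a b : d a b = d b a by case: d_metric.
apply: le_anti; apply/andP; split; apply: lambda_max_le; rewrite ?lambda_max_ge0 // => a b eab.
  have/and3P[aM bM _] := eab; rewrite !inE bM andbT negbK => /andP[ah _] bh.
  by rewrite dC; apply: lambda_max_ge; rewrite // edgeC.
have/and3P[aM bM _] := eab => ah bh.
by rewrite dC; apply: lambda_max_ge; rewrite ?inE ?ah ?bh //= edgeC.
Qed.

Lemma dME M x y : x \in M -> y \in M ->
  dM d mu M x y = \sum_(h <- fpowerset M | [&& halfspace mu M h, x \in h & y \notin h]) lambda_max d mu M h.
Proof.
move=> xM yM; rewrite /dM xM yM /= /sep_half -big_fset_condE.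
by apply: eq_bigl => h; rewrite andbA.
Qed.

Lemma dM_ge0 M x y : 0 <= dM d mu M x y.
Proof. by rewrite /dM; case: ifP => // _; apply: sumr_ge0 => *; exact: lambda_max_ge0. Qed.

Lemma dMxx M x : dM d mu M x x = 0.
Proof.
rewrite /dM; case: ifP => // _; rewrite big_seq big1 // => h.
by rewrite sep_halfE andbN andbF.
Qed.

Lemma dMC M x y : dM d mu M x y = dM d mu M y x.
Proof.
rewrite /dM andbC; case: ifP => // /andP[yM xM].
suff le u v : u \in M -> v \in M -> \sum_(h <- sep_half mu M u v) lambda_max d mu M h <=
    \sum_(h <- sep_half mu M v u) lambda_max d mu M h.
  by apply: le_anti; rewrite !le.
move=> uM vM; under eq_bigr do rewrite -lambda_maxC.
have inj : {in sep_half mu M u v &, injective (fun h => M `\` h)%fset}.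
  move=> h k; rewrite !sep_halfE => /and3P[/and5P[hM _ _ _ _] _ _] /and3P[/and5P[kM _ _ _ _] _ _] E.
  by rewrite -(fsetDK hM) E fsetDK.
rewrite -(big_imfset _ imfset_key (lambda_max d mu M) inj) /=.
rewrite (@eq_fbigl _ _ _ _ _ (sep_half mu M v u)) //= => k; apply/imfsetP/idP => /= [[h hs ->]|ks].
  exact: sep_halfC.
exists (M `\` k)%fset; first exact: sep_halfC.
by rewrite fsetDK //; move: ks; rewrite sep_halfE => /and3P[/and5P[]].
Qed.

Lemma dM_btw M x y z : subalgebra mu M -> x \in M -> y \in M -> z \in M ->
  mu x y z = z -> dM d mu M x y = dM d mu M x z + dM d mu M z y.
Proof.
move=> sM xM yM zM E; rewrite !dME // (bigID (fun h => z \notin h)) /=; congr (_ + _).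
  apply: eq_bigl => h; case hh: (halfspace mu M h) => //=.
  case xh: (x \in h) => //=; case zh: (z \in h); rewrite ?andbF //= andbT.
  apply/negP => yh; move: zh; rewrite -E (halfspace_med sM) //.
apply: eq_bigl => h; case hh: (halfspace mu M h) => //=; rewrite negbK.
case zh: (z \in h); rewrite ?andbF //= andbT.
case yh: (y \in h); rewrite ?andbF //= andbT; apply/negPn/negP => xh.
by move: zh; rewrite -E; apply/negP; apply: (halfspace_medN sM) => //; rewrite yh.
Qed.

(** The map [mu x y] retracts [M] onto the two-point interval, and the fibre over [x] is a
    halfspace. Any separating halfspace equals this fibre, because convexity puts each point on the
    side of its image. *)
Lemma adjacent_edge M x y : subalgebra mu M -> x \in M -> y \in M -> x != y ->
  (forall z, z \in M -> mu x y z = z -> z = x \/ z = y) -> edge mu M x y.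
Proof.
move=> sM xM yM xy adj.
have ret a : a \in M -> mu x y a = x \/ mu x y a = y.
  by move=> aM; apply: adj; [exact: sM|rewrite med_idem].
pose h := [fset a in M | mu x y a == x]%fset.
have hE a : (a \in h) = (a \in M) && (mu x y a == x) by rewrite !inE.
have hs : h \in sep_half mu M x y.
  have yh : y \notin h by rewrite hE yM (medyy mu_median) eq_sym.
  have xh : x \in h by rewrite hE xM (medxyx mu_median) eqxx.
  rewrite sep_halfE yh xh !andbT; apply: (@mk_halfspace _ _ x y) => //.
  - by move=> a; rewrite hE => /andP[].
  - move=> u v w; rewrite !hE => /andP[uM /eqP uE] /andP[vM /eqP vE] wM <-.
    by rewrite sM // (med_retract mu_median) uE vE (medxx mu_median) eqxx.
  - move=> u v w uM vM; rewrite !hE uM vM /= => uE vE wM <-.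
    have -> : mu x y (mu u v w) = y.
      rewrite (med_retract mu_median); have [E|->] := ret u uM; first by rewrite E eqxx in uE.
      by have [E|->] := ret v vM; [rewrite E eqxx in vE|rewrite (medxx mu_median)].
    by rewrite sM //= eq_sym.
rewrite /edge xM yM /=; apply/cardfs1P; exists h; apply/fsetP=> k; rewrite inE.
apply/idP/eqP => [ks|->//]; apply/fsetP=> a.
move: ks; rewrite sep_halfE => /and3P[hk xk yk]; rewrite hE.
case aM: (a \in M) => /=; last by apply/negbTE/negP => /(halfspace_sub hk); rewrite aM.
apply/idP/eqP => [ak|E].
  have [//|E] := ret a aM; move: yk; rewrite -E.
  by rewrite medAC // (halfspace_med sM).
by apply/negPn/negP => ak; have := halfspace_medN sM hk yM aM yk ak xM; rewrite -(medR mu_median) E xk.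
Qed.

(** Subdividing at an intermediate point splits [dM] exactly, while [d] obeys the triangle
    inequality. Adjacent points form an edge, whose length is at most the weight of the only wall
    across it. *)
Lemma d_le_dM M x y : subalgebra mu M -> x \in M -> y \in M -> d x y <= dM d mu M x y.
Proof.
move=> sM; case: (d_metric) => d0 d1 dC dT.
pose I x y := [fset z in M | mu x y z == z]%fset.
have IE u v w : (w \in I u v) = (w \in M) && (mu u v w == w) by rewrite !inE.
have [n] := ubnP #|` I x y|; elim: n x y => // n IH x y In xM yM.
have [<-|xy] := eqVneq x y; first by rewrite (d1 x x).2 // dM_ge0.
have [/existsP[z /and3P[/eqP zE zx zy]]|/existsPn adj] :=
    boolP [exists z : M, [&& mu x y (val z) == val z, val z != x & val z != y]].
  have zM := valP z; move: (val z) zE zx zy zM => {}z zE zx zy zM.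
  have sub u v : u \in M -> v \in M -> mu u v z = z -> z != v -> (I u z `<` I u v)%fset.
    move=> uM vM uvz zv; rewrite fproperE; apply/andP; split.
      apply/fsubsetP=> w; rewrite !IE => /andP[-> /eqP wE] /=.
      by rewrite -{1}wE -(meetsA mu_median) uvz wE.
    apply/fsubsetPn; exists v; rewrite !IE vM /=; first by rewrite (medyy mu_median).
    by rewrite (medAC mu_median) uvz.
  have IC u v : I u v = I v u by apply/fsetP=> w; rewrite !IE (medCA mu_median).
  rewrite (dM_btw sM xM yM zM zE); apply: le_trans (dT x z y) _; apply: lerD; apply: IH => //.
    exact: leq_trans (fproper_ltn_card (sub _ _ xM yM zE zy)) In.
  rewrite IC; apply: leq_trans (fproper_ltn_card (sub _ _ yM xM _ zx)) _; first by rewrite (medCA mu_median).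
  by rewrite IC.
have eE : edge mu M x y.
  apply: adjacent_edge => // z zM zE; have := adj [` zM]%fset; rewrite /= zE eqxx /=.
  by have [->|] := eqVneq z x; [left|have [->|] := eqVneq z y; [right|]].
rewrite /dM xM yM /=; have/and3P[_ _ /cardfs1P[h hE]] := eE.
rewrite hE big_seq_fset1; have : h \in sep_half mu M x y by rewrite hE inE.
by rewrite sep_halfE => /and3P[_]; apply: lambda_max_ge.
Qed.

(** An edge of [M] across [h] may be subdivided in [M'], but every wall of [M'] between its ends has
    trace [h] on [M]. By [d_le_dM] the weights of these walls dominate the length of the edge, and
    walls with different traces are different. *)
Lemma dM_mono M M' x y : subalgebra mu M -> subalgebra mu M' -> {subset M <= M'} ->
  x \in M -> y \in M -> dM d mu M x y <= dM d mu M' x y.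
Proof.
move=> sM sM' MM' xM yM; rewrite {2}/dM !MM' //= {1}/dM xM yM /=.
pose F h := \sum_(k <- sep_half mu M' x y | (M `&` k)%fset == h) lambda_max d mu M' k.
apply: (@le_trans _ _ (\sum_(h <- sep_half mu M x y) F h)); last first.
  rewrite /F (exchange_big_dep xpredT) //= !big_seq; apply: ler_sum => k ks.
  rewrite big_fset_condE; set A := [fset _ in _ | _]%fset.
  have -> : A = [fset (M `&` k)%fset]%fset; last by rewrite big_seq_fset1.
  apply/fsetP=> h; rewrite !inE /= eq_sym; case: eqP => [->|]; rewrite ?andbF // andbT.
  by have := sep_half_restrict sM sM' MM' xM yM ks; rewrite !inE.
rewrite !big_seq; apply: ler_sum => h hs; apply: lambda_max_le.
  by apply: sumr_ge0 => k _; exact: lambda_max_ge0.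
move=> a b eab ah bh; have/and3P[aM bM _] := eab.
apply: le_trans (d_le_dM sM' (MM' _ aM) (MM' _ bM)) _; rewrite /dM !MM' //=.
rewrite /F [leRHS]big_fset_condE; set A := [fset _ in _ | _]%fset.
have sub : (sep_half mu M' a b `<=` A)%fset.
  apply/fsubsetP=> k ks; have kr := sep_half_restrict sM sM' MM' aM bM ks.
  have hab : h \in sep_half mu M a b.
    by move: hs; rewrite !sep_halfE ah bh !andbT => /and3P[].
  have kh := sep_half_uniq eab kr hab.
  have : k \in sep_half mu M' x y.
    move: hs ks; rewrite -{1}kh !sep_halfE !inE xM yM /=.
    by case/and3P=> _ -> -> /and3P[->].
  by move=> kx; apply/imfsetP; exists k => //; apply/andP; split=> //; apply/eqP.
by apply: ler_sum_fsubset => // k _; exact: lambda_max_ge0.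
Qed.

End Walls.

(** * Chains and antichains of walls *)

Section HeavyChain.
Variable R : realType.

Lemma seq_argmin (T : eqType) (s : seq T) (F : T -> R) : s != [::] ->
  exists2 e, e \in s & forall i, i \in s -> F e <= F i.
Proof.
elim: s => // a [|b s] IH _.
  by exists a; rewrite ?inE // => i; rewrite inE => /eqP->.
have [//|e es eF] := IH; have [ae|ea] := leP (F a) (F e).
  exists a; first by rewrite inE eqxx.
  by move=> i; rewrite inE => /orP[/eqP->//|/eF]; apply: le_trans.
exists e; first by rewrite inE es orbT.
by move=> i; rewrite inE => /orP[/eqP->|/eF//]; exact: ltW.
Qed.

Lemma fset_min_card (K : choiceType) (S : {fset {fset K}}) : S != fset0 ->
  exists2 e, e \in S & forall i, i \in S -> (#|` e| <= #|` i|)%N.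
Proof.
case/fset0Pn=> a aS; have [n] := ubnP #|` a|; elim: n a aS => // n IH a aS an.
have [/existsP[b ba]|/existsPn na] := boolP [exists b : S, (#|` val b| < #|` a|)%N].
  by apply: (IH (val b)); [exact: valP|exact: leq_trans ba _].
by exists a => // i iS; have := na [` iS]%fset; rewrite -leqNgt.
Qed.

(* A weighted form of Mirsky's theorem: lowering all minimal weights by their
   minimum lowers the total by at most N times what every maximal chain loses. *)
Lemma heavy_chain (K : choiceType) (N : nat) (S : {fset {fset K}}) (w : {fset K} -> R) :
  (forall h, h \in S -> 0 < w h) ->
  (forall A : {fset {fset K}}, (A `<=` S)%fset ->
     (forall h k, h \in A -> k \in A -> (h `<=` k)%fset -> h = k) -> (#|` A| <= N)%N) ->
  exists C : {fset {fset K}}, [/\ (C `<=` S)%fset,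
     forall h k, h \in C -> k \in C -> (h `<=` k)%fset \/ (k `<=` h)%fset &
     \sum_(h <- S) w h <= N%:R * \sum_(h <- C) w h].
Proof.
have [n] := ubnP #|` S|; elim: n S w => // n IH S w Sn w0 anti.
have [S0|S0] := eqVneq S fset0.
  by exists fset0; rewrite S0; split; rewrite ?fsub0set // big_seq_fset0 mulr0.
pose A := [fset h in S | all (fun k => (k `<=` h)%fset ==> (k == h)) S]%fset.
have AS : (A `<=` S)%fset by apply/fsubsetP=> h; rewrite !inE => /andP[].
have Amin h k : h \in A -> k \in S -> (k `<=` h)%fset -> k = h.
  by rewrite !inE => /andP[_ /allP Ah] /Ah/implyP/[apply]/eqP.
have below s : s \in S -> exists2 m, m \in A & (m `<=` s)%fset.
  move=> sS; pose B := [fset k in S | (k `<=` s)%fset]%fset.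
  have [|m mB mm] := @fset_min_card K B.
    by apply/fset0Pn; exists s; rewrite !inE sS fsubset_refl.
  move: (mB); rewrite !inE => /andP[mS ms]; exists m => //.
  rewrite !inE mS; apply/allP=> k kS; apply/implyP=> km.
  by rewrite eqEfcard km mm // !inE kS (fsubset_trans km).
have A0 : enum_fset A != [::].
  have [s /below[m mA _]] := fset0Pn _ S0.
  by apply/eqP=> E; have : m \in enum_fset A by []; rewrite E.
have [e eA emin] := seq_argmin w A0.
have eS : e \in S by apply: (fsubsetP AS).
have e0 := w0 e eS.
pose w' h := w h - (if h \in A then w e else 0).
have w'0 h : h \in S -> 0 <= w' h.
  by rewrite /w' => hS; case: ifP => [/emin|_]; rewrite subr_ge0 // ltW // w0.
have w'w h : w' h <= w h by rewrite /w' gerBl; case: ifP => // _; exact: ltW.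
pose S' := [fset h in S | 0 < w' h]%fset.
have S'S : (S' `<=` S)%fset by apply/fsubsetP=> h; rewrite !inE => /andP[].
(* The minimizer [e] drops to weight 0 and leaves the support, so the cardinality decreases. *)
have S'n : (#|` S'| < n)%N.
  apply: leq_trans (_ : #|` S| <= n)%N => //; apply: fproper_ltn_card.
  rewrite fproperE S'S; apply/fsubsetPn; exists e => //.
  by rewrite inE /= inE /w' eA subrr ltxx andbF.
have [||C [CS' Cch Cw]] := IH S' w' S'n.
- by move=> h; rewrite !inE => /andP[].
- by move=> B BS' aB; apply: anti => //; exact: fsubset_trans S'S.
have CS := fsubset_trans CS' S'S.
(* Extending the chain downwards by an element of [A] regains the weight [w e] that was subtracted
   there. *)
have [D [DS CD Dch [m mD mA]]] : exists D : {fset {fset K}}, [/\ (D `<=` S)%fset,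
    (C `<=` D)%fset, forall h k, h \in D -> k \in D -> (h `<=` k)%fset \/ (k `<=` h)%fset &
    exists2 m, m \in D & m \in A].
  have [C0|C0] := eqVneq C fset0.
    exists [fset e]%fset; split; rewrite ?C0 ?fsub0set ?fsub1set //.
      by move=> h k; rewrite !inE => /eqP-> /eqP->; left.
    by exists e => //; rewrite inE.
  have [c cC cm] := fset_min_card C0.
  have [m mA mc] := below c (fsubsetP CS c cC).
  have mlow k : k \in C -> (m `<=` k)%fset.
    move=> kC; apply: fsubset_trans mc _; have [//|kc] := Cch _ _ cC kC.
    by have -> : k = c by apply/eqP; rewrite eqEfcard kc cm.
  exists (m |` C)%fset; split.
  - by rewrite fsubUset fsub1set (fsubsetP AS).
  - by rewrite fsubsetUr.
  - move=> h k; rewrite !inE => /orP[/eqP->|hC] /orP[/eqP->|kC]; [by left| | |exact: Cch].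
    + by left; exact: mlow.
    + by right; exact: mlow.
  - by exists m; rewrite // !inE eqxx.
exists D; split=> //.
have HD : \sum_(h <- C) w' h + w e <= \sum_(h <- D) w h.
  apply: (@le_trans _ _ (\sum_(h <- D) w' h + w e)).
    by rewrite lerD2r; apply: ler_sum_fsubset => // i iD; apply: w'0; exact: (fsubsetP DS).
  rewrite !(big_fsetD1 m mD) /= {1}/w' mA addrAC subrK lerD2l.
  by apply: ler_sum.
have HS : \sum_(h <- S) w h <= \sum_(h <- S') w' h + w e * N%:R.
  have -> : \sum_(h <- S) w h = \sum_(h <- S) w' h + \sum_(h <- S) (if h \in A then w e else 0).
    by rewrite -big_split /=; apply: eq_bigr => h _; rewrite subrK.
  apply: lerD.
    rewrite (big_fsetID _ (fun h => 0 < w' h)) /= gerDl big_seq.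
    by apply: sumr_le0 => h; rewrite !inE -leNgt => /andP[].
  rewrite -big_mkcond big_fset_condE /=.
  have -> : [fset i in S | i \in A]%fset = A.
    apply/fsetP=> i; apply/idP/idP => [|iA]; first by case/imfsetP=> j /= /andP[_ ?] ->.
    by apply/imfsetP; exists i => //; apply/andP; split=> //; exact: (fsubsetP AS).
  rewrite big_const_seq count_predT iter_addr addr0 -[w e *+ _]mulr_natr.
  apply: ler_wpM2l; first exact: ltW.
  by rewrite ler_nat; apply: anti => // h k hA kA; apply: Amin => //; exact: (fsubsetP AS).
apply: le_trans HS _; apply: le_trans (lerD Cw (lexx _)) _.
by rewrite (mulrC (w e)) -mulrDr; apply: ler_wpM2l.
Qed.
End HeavyChain.

(** * Cubes spanned by antichains of walls *)

Section Cubes.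
Variables (X : choiceType) (mu : X -> X -> X -> X).
Hypothesis mu_median : median_algebra mu.
Variable M : {fset X}.
Hypothesis sM : subalgebra mu M.

(** For halfspaces that contain [x] and miss [y], the constant sign [false] describes the orthant of
    [x] and [true] that of [y]. *)
Let side (h : {fset X}) (b : bool) : X -> Prop := fun a => a \in M /\ (a \in h) = ~~ b.

Lemma side_convex h b : halfspace mu M h -> mconvex mu (fun a => a \in M) (side h b).
Proof.
move=> hh a c e [aM ah] [cM ch] eM; split; first exact: sM.
case: b ah ch => /= ah ch; last exact: (halfspace_med mu_median sM hh).
by apply/negbTE; apply: (halfspace_medN mu_median sM hh); rewrite ?ah ?ch.
Qed.

(** Moving [p] into the interval can only lose separating walls; under the minimality used in
    [antichain_cube] none is lost. *)
Lemma sep_half_btw p q z : p \in M -> q \in M -> z \in M ->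
  (sep_half mu M (mu p q z) q `<=` sep_half mu M p q)%fset.
Proof.
move=> pM qM zM; apply/fsubsetP=> h; rewrite !sep_halfE => /and3P[hh zh qh].
rewrite hh qh andbT /=; apply/negPn/negP => ph.
by have := halfspace_medN mu_median sM hh pM qM ph qh zM; rewrite zh.
Qed.

(* If p and q lie in opposite orthants of the walls in A with as few walls between
   them as possible, then the walls separating p from q are exactly those in A. *)
Lemma antichain_cube x y (A : {fset {fset X}}) : x \in M -> y \in M ->
  (A `<=` sep_half mu M x y)%fset ->
  (forall h k, h \in A -> k \in A -> (h `<=` k)%fset -> h = k) -> has_cube mu M #|` A|.
Proof.
move=> xM yM AS anti; set k := #|` A|.
pose H (i : 'I_k) : {fset X} := nth fset0 (enum_fset A) i.
have HA i : H i \in A by apply: mem_nth.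
have Hhalf i : [/\ halfspace mu M (H i), x \in H i & y \notin H i].
  by apply/and3P; rewrite -sep_halfE; apply: (fsubsetP AS).
have Hinj i j : (H i `<=` H j)%fset -> i = j.
  move/(anti _ _ (HA i) (HA j))/eqP; rewrite nth_uniq ?fset_uniq // => /eqP; exact: val_inj.
have Hmeet i j (b c : bool) : (i = j -> b = c) ->
    exists a, side (H i) b a /\ side (H j) c a.
  have [[hi xi yi] [hj xj yj]] := (Hhalf i, Hhalf j).
  have incomp u v : u <> v -> exists a, [/\ a \in M, a \in H u & a \notin H v].
    move=> uv; have /fsubsetPn[a au av] : ~~ (H u `<=` H v)%fset by apply/negP => /Hinj.
    by exists a; split=> //; have [hu _ _] := Hhalf u; exact: (halfspace_sub hu).
  have [<-|ij] := eqVneq i j.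
    move=> /(_ erefl) <-; case: b; [exists y|exists x]; rewrite /side xM || rewrite /side yM;
    by rewrite ?xi ?(negPf yi).
  move=> _; case: b c => [] [].
  - by exists y; rewrite /side yM (negPf yi) (negPf yj).
  - have [a [aM aj ai]] := incomp j i (fun E => negP ij (introT eqP (esym E))).
    by exists a; rewrite /side aM aj (negPf ai).
  - have [a [aM ai aj]] := incomp i j (elimN eqP ij).
    by exists a; rewrite /side aM ai (negPf aj).
  - by exists x; rewrite /side xM xi xj.
(* Pairwise intersections suffice by Helly's theorem; the extra convex set [P] serves later to test
   whether an orthant reaches across another wall. *)
have orthant (P : X -> Prop) (v : 'I_k -> bool) : mconvex mu (fun a => a \in M) P ->
    (forall a, P a -> a \in M) -> (exists a, P a) ->
    (forall i, exists a, P a /\ side (H i) (v i) a) ->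
    exists a, P a /\ forall i, side (H i) (v i) a.
  move=> cP PM Pne Pm.
  pose B (i : 'I_k.+1) := if unlift ord0 i is Some j then side (H j) (v j) else P.
  have [i a|i|i j|a Ba] := @helly X mu mu_median (fun a => a \in M) k B.
  - by rewrite /B; case: unliftP => [j|] _; [case|exact: PM].
  - rewrite /B; case: unliftP => [j|] _ //; apply: side_convex; by case: (Hhalf j).
  - rewrite /B; case: unliftP => [i'|] _; case: unliftP => [j'|] _ //.
    + by apply: Hmeet => ->.
    + by have [a [? ?]] := Pm i'; exists a.
    + by have [a ?] := Pne; exists a.
  - exists a; split; first by have := Ba ord0; rewrite /B unlift_none.
    by move=> i; have := Ba (lift ord0 i); rewrite /B liftK.
have cM : mconvex mu (fun a => a \in M) (fun a => a \in M).
  by move=> a b c *; apply: sM.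
have pts v : exists a, a \in M /\ forall i, side (H i) (v i) a.
  apply: orthant => //; first by exists x.
  by move=> i; have [a [[aM ?] _]] := Hmeet i i (v i) (v i) (fun _ => erefl); exists a.
pose F (b : bool) := [fset a in M | [forall i, (a \in H i) == ~~ b]]%fset.
have FP b a : reflect (a \in M /\ forall i, side (H i) b a) (a \in F b).
  rewrite !inE; apply: (iffP andP) => [[aM /forallP aH]|[aM aH]]; split=> //.
    by move=> i; split=> //; apply/eqP.
  by apply/forallP=> i; apply/eqP; case: (aH i).
have [[p0 /FP p0F] [q0 /FP q0F]] := (pts (fun=> false), pts (fun=> true)).
have [p [q [pF qF pqmin]]] : exists p q, [/\ p \in F false, q \in F true &
    forall p' q', p' \in F false -> q' \in F true ->
      (#|` sep_half mu M p q| <= #|` sep_half mu M p' q'|)%N].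
  have [n] := ubnP #|` sep_half mu M p0 q0|; elim: n p0 q0 p0F q0F => // n IH p0 q0 p0F q0F pqn.
  have [[p' [q' [p'F q'F lt]]]|no] := pselect (exists p q, [/\ p \in F false, q \in F true &
     (#|` sep_half mu M p q| < #|` sep_half mu M p0 q0|)%N]).
    by apply: (IH p' q') => //; exact: leq_trans lt _.
  exists p0, q0; split=> // p' q' p'F q'F; rewrite leqNgt; apply/negP => lt.
  by apply: no; exists p', q'.
have [pM pH] := elimT (FP _ _) pF; have [qM qH] := elimT (FP _ _) qF.
have Fmed b u v z : u \in F b -> v \in F b -> z \in M -> mu u v z \in F b.
  move=> /FP[uM uH] /FP[vM vH] zM; apply/FP; split; first exact: sM.
  by move=> i; apply: side_convex => //; case: (Hhalf i).
have sepeq p' q' : p' \in F false -> q' \in F true ->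
    (sep_half mu M p' q' `<=` sep_half mu M p q)%fset -> sep_half mu M p' q' = sep_half mu M p q.
  by move=> p'F q'F sub; apply/eqP; rewrite eqEfcard sub pqmin.
(* The projection [mu p q z] stays in the orthant, so by minimality it is still separated from [q]
   by [h]; then [z] cannot lie on the side of [q]. *)
have F0 h z : h \in sep_half mu M p q -> z \in F false -> z \in h.
  move=> hs zF; have /FP[zM _] := zF.
  have mF : mu p q z \in F false by rewrite (medAC mu_median); exact: Fmed.
  move: (hs); rewrite -(sepeq _ _ mF qF (sep_half_btw pM qM zM)) sep_halfE => /and3P[hh mh qh].
  apply/negPn/negP=> zh; have := halfspace_medN mu_median sM hh qM zM qh zh pM.
  by rewrite -(medR mu_median) mh.
have F1 h z : h \in sep_half mu M p q -> z \in F true -> z \notin h.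
  move=> hs zF; have /FP[zM _] := zF.
  have mF : mu q p z \in F true by rewrite (medAC mu_median); exact: Fmed.
  have E : sep_half mu M p (mu q p z) = sep_half mu M p q.
    apply: sepeq => //; apply/fsubsetP=> h' h's.
    have h'M : (h' `<=` M)%fset by move: h's; rewrite sep_halfE => /and3P[/and5P[]].
    have := sep_halfC pM (sM qM pM zM) h's; move/(fsubsetP (sep_half_btw qM pM zM)).
    by move/(sep_halfC qM pM); rewrite fsetDK.
  move: (hs); rewrite -E sep_halfE => /and3P[hh ph mh].
  apply/negP=> zh; have := halfspace_med mu_median sM hh ph zh qM.
  by rewrite -(medR mu_median) (negPf mh).
(* If [h] contained no [H i], its complement would meet the orthant of [p], against [F0]; dually [h]
   lies in some [H j]. The antichain condition closes the sandwich. *)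
have sepP h : h \in sep_half mu M p q -> exists i, h = H i.
  move=> hs; move: (hs); rewrite sep_halfE => /and3P[hh ph qh].
  have [i hi] : exists i, forall a, a \in H i -> a \in h.
    apply: contrapT => no.
    have [||||a [[aM ah] aH]] := orthant (side h true) (fun=> false).
    - exact: side_convex.
    - by move=> a [].
    - by exists q; split=> //; exact/negbTE.
    - move=> i; apply: contrapT => ni; apply: no; exists i => a ai; apply/negPn/negP=> ah.
      have [hi _ _] := Hhalf i; have aM := halfspace_sub hi ai.
      by apply: ni; exists a; rewrite /side aM ai (negPf ah).
    - by have /(F0 _ _ hs) : a \in F false by [apply/FP]; rewrite ah.
  have [j hj] : exists j, forall a, a \in h -> a \in H j.
    apply: contrapT => no.
    have [||||a [[aM ah] aH]] := orthant (side h false) (fun=> true).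
    - exact: side_convex.
    - by move=> a [].
    - by exists p; split=> //.
    - move=> j; apply: contrapT => ni; apply: no; exists j => a ai; apply/negPn/negP=> ah.
      have aM := halfspace_sub hh ai.
      by apply: ni; exists a; rewrite /side aM ai (negPf ah).
    - by have /(F1 _ _ hs) : a \in F true by [apply/FP]; rewrite ah.
  have E : i = j by apply: Hinj; apply/fsubsetP=> a /hi/hj.
  by exists i; apply/fsetP=> a; apply/idP/idP => [/hj|/hi//]; rewrite E.
have [z zP] := choice pts.
(* Orthant points are projected to the interval of [p] and [q], so that no wall outside [A]
   separates the vertices. *)
pose f (v : {ffun 'I_k -> bool}) := mu p q (z v).
have fM v : f v \in M by apply: sM => //; case: (zP v).
have fH v i : (f v \in H i) = ~~ v i.
  have [zM zH] := zP v; have [hi _ _] := Hhalf i.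
  have [_ zi] := zH i; have [_ pi] := pH i; have [_ qi] := qH i; rewrite /f.
  case: (v i) zi => /= zi.
    apply/negbTE; rewrite (medR mu_median); apply: (halfspace_medN mu_median sM) => //.
      by rewrite qi.
    by rewrite zi.
  by rewrite (medAC mu_median); apply: (halfspace_med mu_median sM).
exists f; split=> //.
  by move=> v w E; apply/ffunP=> i; apply: negb_inj; rewrite -!fH E.
have sepf v w g : g \in sep_half mu M (f v) (f w) ->
    exists i, (g = H i /\ ~~ v i && w i) \/ (g = (M `\` H i)%fset /\ v i && ~~ w i).
  rewrite sep_halfE => /and3P[hg vg wg].
  have [pg|pg] := boolP (p \in g); have [qg|qg] := boolP (q \in g).
  - by move: wg; rewrite /f (halfspace_med mu_median sM) //; case: (zP w).
  - have [i E] : exists i, g = H i by apply: sepP; rewrite sep_halfE hg pg.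
    by exists i; left; split=> //; move: vg wg; rewrite E !fH negbK => -> ->.
  - have [i E] : exists i, (M `\` g)%fset = H i.
      by apply: sepP; rewrite sep_halfE halfspaceC //= !inE pg qg pM.
    have gM : (g `<=` M)%fset by case/and5P: hg.
    exists i; right; rewrite -E fsetDK //; split=> //.
    by rewrite -[v i]negbK -[w i]negbK -!fH -E !inE vg wg !fM.
  - by have := halfspace_medN mu_median sM hg pM qM pg qg (zP v).1; rewrite -/(f v) vg.
move=> v w /eqP/cards1P[i vw].
have vwE j : (v j != w j) = (j == i) by move/setP/(_ j): vw; rewrite !inE.
rewrite /edge !fM /=; apply/cardfs1P.
have [hi _ _] := Hhalf i; have hiM : (H i `<=` M)%fset by case/and5P: hi.
exists (if v i then (M `\` H i)%fset else H i); apply/fsetP=> g; apply/idP/fset1P => [/sepf[j [[-> /andP[vj wj]]|[-> /andP[vj wj]]]]|->].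
- have/eqP <- : j == i by rewrite -vwE (negPf vj) wj.
  by rewrite (negPf vj).
- have/eqP <- : j == i by rewrite -vwE vj (negPf wj).
  by rewrite vj.
- have := vwE i; rewrite eqxx; have := fH v i; have := fH w i.
  rewrite sep_halfE; case: (v i) => /=; case: (w i) => //= wi vi _.
    by rewrite halfspaceC //= !inE wi vi !fM.
  by rewrite hi vi wi.
Qed.
End Cubes.

(** * Monotone functions from chains of walls *)

Definition interval_monotone (R : realType) (X : Type) (mu : X -> X -> X -> X)
    (U : X -> Prop) (f : X -> R) : Prop :=
  forall u v z, U u -> U v -> U z -> mu u v z = z ->
    Num.min (f u) (f v) <= f z <= Num.max (f u) (f v).

Section FiniteChain.
Variables (R : realType) (X : choiceType) (d : X -> X -> R) (mu : X -> X -> X -> X).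
Hypotheses (mu_median : median_algebra mu) (d_metric : is_metric d).

(** The function adds the weights of the chain walls crossed on the way from [x]. Since the
    halfspaces are nested, of two points one has crossed every wall that the other has; this gives
    monotonicity on intervals. Each wall counted in a difference of values is also counted in [dM],
    whence the Lipschitz bound. *)
Lemma chain_function (N : nat) (M : {fset X}) x y :
  (forall M n, subalgebra mu M -> has_cube mu M n -> (n <= N)%N) ->
  subalgebra mu M -> x \in M -> y \in M ->
  exists f : X -> R, [/\ interval_monotone mu (fun a => a \in M) f,
    forall p q, p \in M -> q \in M -> f p - f q <= dM d mu M q p, f x = 0 &
    dM d mu M x y <= N%:R * f y].
Proof.
move=> rk sM xM yM.
pose lam := lambda_max d mu M; have lam0 h : 0 <= lam h by exact: lambda_max_ge0.
(* [heavy_chain] asks for positive weights; walls of weight 0 contribute nothing to [dM]. *)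
pose S := [fset h in sep_half mu M x y | 0 < lam h]%fset.
have Ssub : (S `<=` sep_half mu M x y)%fset.
  by apply/fsubsetP=> h /imfsetP[k /= /andP[? _] ->].
have [|A AS anti|C [CS Cch Cw]] := @heavy_chain R X N S lam.
- by move=> h /imfsetP[k /= /andP[]] _ ? ->.
- apply: (rk M) => //; apply: (antichain_cube mu_median sM xM yM) => //.
  exact: fsubset_trans Ssub.
have Chalf h : h \in C -> [/\ halfspace mu M h, x \in h & y \notin h].
  by move=> hC; apply/and3P; rewrite -sep_halfE; apply: (fsubsetP Ssub); apply: (fsubsetP CS).
pose f p := \sum_(h <- C | p \notin h) lam h.
have fmono u v : (forall h, h \in C -> u \notin h -> v \notin h) -> f u <= f v.
  move=> sub; rewrite /f big_seq_cond [leRHS]big_seq_cond big_mkcond [leRHS]big_mkcond /=.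
  apply: ler_sum => h _; case: ifP => [/andP[hC uh]|_]; first by rewrite hC sub.
  by case: ifP.
have nest u v : (forall h, h \in C -> u \notin h -> v \notin h) \/
                (forall h, h \in C -> v \notin h -> u \notin h).
  have [|no] := pselect (forall h, h \in C -> u \notin h -> v \notin h); [by left|right].
  move=> k kC vk; apply/negP => uk; apply: no => h hC uh; apply/negP => vh.
  have [/fsubsetP hk|/fsubsetP kh] := Cch _ _ hC kC.
    by rewrite hk in vk.
  by rewrite kh in uh.
have btw u v z : (forall h, h \in C -> u \notin h -> v \notin h) -> u \in M -> v \in M -> z \in M ->
    mu u v z = z -> f u <= f z <= f v.
  move=> uv uM vM zM zE; apply/andP; split; apply: fmono => h hC; have [hh _ _] := Chalf h hC.
    by move=> uh; rewrite -zE; apply: (halfspace_medN mu_median sM hh) => //; exact: uv.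
  move=> zh; apply/negP => vh; have [uh|uh] := boolP (u \in h); last by have := uv h hC uh; rewrite vh.
  by move: zh; rewrite -zE (halfspace_med mu_median sM hh).
exists f; split.
- move=> u v z uM vM zM zE; have [uv|vu] := nest u v.
    have /andP[l r] := btw u v z uv uM vM zM zE; have uvf := le_trans l r.
    by rewrite (min_idPl uvf) (max_idPr uvf) l r.
  have /andP[l r] : f v <= f z <= f u by apply: btw => //; rewrite (medCA mu_median).
  have uvf := le_trans l r; by rewrite (min_idPr uvf) (max_idPl uvf) l r.
- move=> p q pM qM; rewrite /dM pM qM /=.
  have -> : f p = \sum_(h <- C | (p \notin h) && (q \notin h)) lam h +
                  \sum_(h <- C | (p \notin h) && (q \in h)) lam h.
    rewrite /f (bigID (fun h => q \notin h)) /=; congr (_ + _).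
    by apply: eq_bigl => h; rewrite negbK.
  rewrite addrAC; apply: (@le_trans _ _ (\sum_(h <- C | (p \notin h) && (q \in h)) lam h)).
    rewrite gerDr subr_le0 /f big_mkcond [leRHS]big_mkcond /=; apply: ler_sum => h _.
    by case: (p \notin h) => /=; case: (q \notin h).
  rewrite big_fset_condE /=; apply: ler_sum_fsubset => //.
  apply/fsubsetP=> h /imfsetP[k /= /andP[kC /andP[pk qk]] ->].
  by rewrite sep_halfE pk qk; have [-> _ _] := Chalf k kC.
- rewrite /f big_seq_cond big1 // => h /andP[hC].
  by have [_ ->] := Chalf h hC.
- have -> : f y = \sum_(h <- C) lam h.
    rewrite /f big_mkcond !big_seq; apply: eq_bigr => h hC.
    by have [_ _ ->] := Chalf h hC.
  apply: le_trans Cw; rewrite /dM xM yM /= (big_fsetID _ (fun h => 0 < lam h)) /= gerDl big_seq.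
  by apply: sumr_le0 => h /imfsetP[k /= /andP[_]]; rewrite -leNgt => ? ->.
Qed.
End FiniteChain.

(** * Invariance of the finite metrics under automorphisms *)

Section Transport.
Variables (R : realType) (X : choiceType) (d : X -> X -> R) (mu : X -> X -> X -> X).
Hypotheses (mu_median : median_algebra mu) (d_metric : is_metric d).

Definition automorphism_pair (g g' : X -> X) : Prop :=
  [/\ cancel g g', cancel g' g, forall x y, d (g x) (g y) = d x y &
      forall x y z, g (mu x y z) = mu (g x) (g y) (g z)].

Lemma automorphism_pairC g g' : automorphism_pair g g' -> automorphism_pair g' g.
Proof.
move=> [gK g'K gd gm]; split=> // [x y|x y z]; first by rewrite -gd !g'K.
by apply: (can_inj gK); rewrite gm !g'K.
Qed.

Let im (g : X -> X) (h : {fset X}) := [fset g x | x in h]%fset.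

Lemma mem_im g g' h x : automorphism_pair g g' -> (x \in im g h) = (g' x \in h).
Proof.
move=> [gK g'K _ _]; apply/imfsetP/idP => [[y /= yh ->]|xh]; first by rewrite gK.
by exists (g' x); rewrite // g'K.
Qed.

Lemma imK g g' h : automorphism_pair g g' -> im g' (im g h) = h.
Proof.
move=> a; apply/fsetP=> x; rewrite (mem_im _ _ (automorphism_pairC a)) (mem_im _ _ a).
by case: a => ->.
Qed.

Lemma im_subalgebra g g' M : automorphism_pair g g' -> subalgebra mu M -> subalgebra mu (im g M).
Proof.
move=> a sM x y z; rewrite !(mem_im _ _ a) => ? ? ?.
by case: (automorphism_pairC a) => _ _ _ ->; apply: sM.
Qed.

Lemma im_sep g g' M x y h : automorphism_pair g g' -> subalgebra mu M -> x \in M -> y \in M ->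
  h \in sep_half mu M x y -> im g h \in sep_half mu (im g M) (g x) (g y).
Proof.
move=> a sM xM yM; rewrite !sep_halfE => /and3P[hh xh yh].
have [gK g'K gd gm] := a; have [_ _ _ gm'] := automorphism_pairC a.
rewrite !(mem_im _ _ a) !gK xh yh !andbT; apply: (@mk_halfspace _ _ _ _ (g x) (g y)).
- by move=> u; rewrite !(mem_im _ _ a); apply: halfspace_sub hh _.
- by rewrite (mem_im _ _ a) gK.
- by rewrite (mem_im _ _ a) gK.
- by rewrite (mem_im _ _ a) gK.
- move=> u v w; rewrite !(mem_im _ _ a) => ? ? ? <-; rewrite gm'.
  exact: (halfspace_med mu_median sM hh).
- move=> u v w; rewrite !(mem_im _ _ a) => ? ? ? ? ? <-; rewrite gm'.
  exact: (halfspace_medN mu_median sM hh).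
Qed.

Lemma im_sepE g g' M x y : automorphism_pair g g' -> subalgebra mu M -> x \in M -> y \in M ->
  sep_half mu (im g M) (g x) (g y) = [fset im g h | h in sep_half mu M x y]%fset.
Proof.
move=> a sM xM yM; have a' := automorphism_pairC a; have [gK g'K gd gm] := a.
apply/fsetP=> k; apply/idP/imfsetP => [ks|[h /= hs ->]]; last exact: (im_sep a sM xM yM hs).
exists (im g' k); last by rewrite (imK _ a').
have := im_sep a' (im_subalgebra a sM) _ _ ks; rewrite !(mem_im _ _ a) !gK (imK _ a).
exact.
Qed.

Lemma im_edge g g' M x y : automorphism_pair g g' -> subalgebra mu M -> x \in M -> y \in M ->
  edge mu (im g M) (g x) (g y) = edge mu M x y.
Proof.
move=> a sM xM yM; have [gK _ _ _] := a.
rewrite /edge !(mem_im _ _ a) !gK xM yM /= (im_sepE a sM xM yM) card_in_imfset //=.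
by move=> h k _ _ /(congr1 (im g')); rewrite !(imK _ a).
Qed.

Lemma im_lambda_max g g' M h : automorphism_pair g g' -> subalgebra mu M ->
  lambda_max d mu M h = lambda_max d mu (im g M) (im g h).
Proof.
move=> a sM; have [gK g'K gd _] := a.
apply: le_anti; apply/andP; split; apply: lambda_max_le; rewrite ?(lambda_max_ge0 mu d_metric) //.
  move=> u v uv uh vh; have/and3P[uM vM _] := uv; rewrite -gd.
  by apply: lambda_max_ge; rewrite ?(im_edge a sM) // (mem_im _ _ a) gK.
move=> u v; rewrite -(g'K u) -(g'K v) => uv; have/and3P[] := uv.
rewrite !(mem_im _ _ a) !gK => uM vM _ uh vh; rewrite gd.
by apply: lambda_max_ge; rewrite // -(im_edge a sM).
Qed.

Lemma im_dM g g' M x y : automorphism_pair g g' -> subalgebra mu M ->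
  dM d mu (im g M) (g x) (g y) = dM d mu M x y.
Proof.
move=> a sM; have [gK _ _ _] := a; rewrite /dM !(mem_im _ _ a) !gK.
case: ifP => // /andP[xM yM]; rewrite (im_sepE a sM xM yM) big_imfset /=.
  by apply: eq_bigr => h _; rewrite -(im_lambda_max _ a sM).
by move=> h k _ _ /(congr1 (im g')); rewrite !(imK _ a).
Qed.

End Transport.

(** * The median metric [delta] *)

Section MedianMetric.
Variables (R : realType) (X : choiceType) (d : X -> X -> R) (mu : X -> X -> X -> X).
Hypotheses (mu_median : median_algebra mu) (d_metric : is_metric d).
Variable L : R.
Hypothesis dL : forall x y, (d_mu d mu x y <= (L * d x y)%:E)%E.

(** The default of [fine] at infinite values never occurs: uniform rectifiability makes [d_mu]
    finite, as [d_muE] records. *)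
Definition delta x y : R := fine (d_mu d mu x y).

Lemma d_muE x y : d_mu d mu x y = (delta x y)%:E.
Proof.
rewrite /delta fineK // fin_numE; apply/andP; split; last first.
  by rewrite lt_eqF // (le_lt_trans (dL x y)) // ltry.
rewrite gt_eqF // (lt_le_trans (ltNyr 0)) //.
apply: ereal_sup_ubound; exists fset0; last by rewrite /dM in_fset0.
by move=> a b c; rewrite in_fset0.
Qed.

Lemma dM_le_delta M x y : subalgebra mu M -> dM d mu M x y <= delta x y.
Proof.
by move=> sM; rewrite -lee_fin -d_muE; apply: ereal_sup_ubound; exists M.
Qed.

(** Any finite subalgebra can be enlarged to contain [x] and [y] without decreasing [dM], which is 0
    by convention when one of them is missing. *)
Lemma delta_le x y C : (forall M, subalgebra mu M -> x \in M -> y \in M -> dM d mu M x y <= C) ->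
  delta x y <= C.
Proof.
move=> dC; rewrite -lee_fin -d_muE; apply: ge_ereal_sup => _ [M sM <-].
rewrite lee_fin; have [M' [sM' MM' /= xy]] := subalgebra_ext mu_median [:: x; y] sM.
have xM' : x \in M' by apply: xy; rewrite inE eqxx.
have yM' : y \in M' by apply: xy; rewrite !inE eqxx orbT.
apply: le_trans (dC M' sM' xM' yM').
have [/andP[xM yM]|no] := boolP ((x \in M) && (y \in M)); first exact: dM_mono.
by rewrite {1}/dM (negPf no) dM_ge0.
Qed.

Lemma delta_le_d x y : delta x y <= L * d x y.
Proof. by rewrite -lee_fin -d_muE. Qed.

Lemma d_le_delta x y : d x y <= delta x y.
Proof.
have [M [sM xy]] := subalgebra_gen mu_median [:: x; y].
apply: le_trans (dM_le_delta x y sM); apply: d_le_dM => //; apply: xy; by rewrite !inE eqxx ?orbT.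
Qed.

Lemma delta_ge0 x y : 0 <= delta x y.
Proof. by apply: le_trans (d_le_delta x y); case: d_metric. Qed.

Lemma deltaC x y : delta x y = delta y x.
Proof.
suff le u v : delta u v <= delta v u by apply: le_anti; rewrite !le.
by apply: delta_le => M sM _ _; rewrite dMC //; exact: dM_le_delta.
Qed.

Lemma deltaxx x : delta x x = 0.
Proof.
by apply: le_anti; rewrite delta_ge0 andbT; apply: delta_le => M sM _ _; rewrite dMxx.
Qed.

Lemma delta_eq0 x y : delta x y <= 0 -> x = y.
Proof.
move=> h; have [d0 d1 _ _] := d_metric; apply/d1; apply: le_anti.
by rewrite d0 andbT (le_trans (d_le_delta x y)).
Qed.

(** Directedness and [dM_mono] let a single subalgebra serve finitely many pairs at once. *)
Lemma delta_approx (s : seq X) (e : R) : 0 < e -> exists M : {fset X},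
  [/\ subalgebra mu M, {subset s <= M} &
      forall x y, x \in s -> y \in s -> delta x y - e < dM d mu M x y].
Proof.
move=> e0.
suff [M [sM subM MP]] : exists M : {fset X}, [/\ subalgebra mu M, {subset s <= M} &
      forall xy, xy \in [seq (x, y) | x <- s, y <- s] -> delta xy.1 xy.2 - e < dM d mu M xy.1 xy.2].
  by exists M; split=> // x y xs ys; apply: (MP (x, y)); apply/allpairsP; exists (x, y).
have : {subset [seq (x, y) | x <- s, y <- s] <= [seq (x, y) | x <- s, y <- s]} by [].
elim: {1 3}[seq _ | _ <- _, _ <- _] => [_|[x y] l IH sl].
  by have [M [sM subM]] := subalgebra_gen mu_median s; exists M.
have [|M [sM subM MP]] := IH; first by move=> q ql; apply: sl; rewrite inE ql orbT.
have /allpairsP[[x' y'] /= [xs ys [? ?]]] := sl (x, y) (mem_head _ _); subst x' y'.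
have [M1 [sM1 lt1 xM1 yM1]] : exists M1 : {fset X}, [/\ subalgebra mu M1,
    delta x y - e < dM d mu M1 x y, x \in M1 & y \in M1].
  apply: contrapT => no; suff : delta x y <= delta x y - e by lra.
  apply: delta_le => M1 sM1 xM1 yM1; rewrite leNgt; apply/negP => lt.
  by apply: no; exists M1.
have [M' [sM' MM' M1M']] := subalgebra_directed mu_median M1 sM.
exists M'; split=> // [u /subM/MM' //|[u v]]; rewrite inE => /orP[/eqP[-> ->]|uv] /=.
  by apply: lt_le_trans lt1 _; apply: dM_mono.
have /allpairsP[[u' v'] /= [us vs [? ?]]] : (u, v) \in [seq (x, y) | x <- s, y <- s].
  by apply: sl; rewrite inE uv orbT.
subst u' v'; apply: lt_le_trans (MP _ uv) _; apply: dM_mono => //; exact: subM.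
Qed.

Lemma delta_btw x y z : mu x y z = z -> delta x y = delta x z + delta z y.
Proof.
move=> E; apply: le_anti; apply/andP; split.
  apply: delta_le => M sM xM yM.
  have [M' [sM' MM' zM']] := subalgebra_adjoin mu_median z sM.
  apply: (le_trans (dM_mono mu_median d_metric sM sM' MM' xM yM)).
  rewrite (dM_btw d mu_median sM' (MM' _ xM) (MM' _ yM) zM' E).
  by apply: lerD; exact: dM_le_delta.
apply/ler_addgt0Pr => e e0; have [|M [sM sub MP]] := @delta_approx [:: x; y; z] (e / 2).
  exact: divr_gt0.
have [xs ys zs] : [/\ x \in [:: x; y; z], y \in [:: x; y; z] & z \in [:: x; y; z]].
  by rewrite !inE !eqxx !orbT.
have := dM_le_delta x y sM.
rewrite (dM_btw d mu_median sM (sub _ xs) (sub _ ys) (sub _ zs) E).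
have := MP x z xs zs; have := MP z y zs ys; lra.
Qed.

(** All three distances split at the median [mu x z y]; the two sides differ by twice its distance
    from [y]. *)
Lemma delta_triangle x y z : delta x z <= delta x y + delta y z.
Proof.
have Ex := delta_btw (med_idem mu_median x z y).
have E1 : mu x y (mu x z y) = mu x z y by rewrite (medAC mu_median x z y) med_idem.
have E2 : mu y z (mu x z y) = mu x z y.
  by rewrite (medR mu_median x z y) (medCA mu_median z y x) med_idem.
have := delta_btw E1; have := delta_btw E2; have := delta_ge0 y (mu x z y).
rewrite (deltaC (mu x z y) y); lra.
Qed.

Lemma delta_automorphism g g' x y : automorphism_pair d mu g g' ->
  delta (g x) (g y) = delta x y.
Proof.
suff le h h' u v : automorphism_pair d mu h h' -> delta u v <= delta (h u) (h v).
  move=> a; apply: le_anti; rewrite (le g g') // andbT.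
  have [gK _ _ _] := a; rewrite -{2}(gK x) -{2}(gK y).
  exact: le (automorphism_pairC a).
move=> a; apply: delta_le => M sM _ _; rewrite -(im_dM mu_median d_metric u v a sM).
exact: (dM_le_delta _ _ (im_subalgebra a sM)).
Qed.

End MedianMetric.

(** * Kernels and limits over finite subalgebras *)

Section Kernel.
Variable R : realType.

(** A list of weighted points, repetitions allowed, stands for a finitely supported signed measure,
    so concatenation is addition. *)
Definition qform (Y : Type) (K : Y -> Y -> R) (l : seq (R * Y)) : R :=
  \sum_(p <- l) \sum_(q <- l) p.1 * q.1 * K p.2 q.2.

Definition pos_def (Y : Type) (K : Y -> Y -> R) : Prop := forall l, 0 <= qform K l.

Lemma qform_scale (Y : Type) (K : Y -> Y -> R) (a : Y -> R) l :
  qform K [seq (p.1 * a p.2, p.2) | p <- l] = qform (fun x y => a x * a y * K x y) l.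
Proof.
rewrite /qform big_map; apply: eq_bigr => p _; rewrite big_map; apply: eq_bigr => q _ /=.
by ring.
Qed.

Lemma qformD (Y : Type) (K K' : Y -> Y -> R) l :
  qform (fun x y => K x y + K' x y) l = qform K l + qform K' l.
Proof.
rewrite /qform -big_split; apply: eq_bigr => p _; rewrite -big_split; apply: eq_bigr => q _ /=.
by rewrite mulrDr.
Qed.

Lemma qformZ (Y : Type) (K : Y -> Y -> R) a l :
  qform (fun x y => a * K x y) l = a * qform K l.
Proof.
rewrite /qform mulr_sumr; apply: eq_bigr => p _; rewrite mulr_sumr; apply: eq_bigr => q _ /=.
by ring.
Qed.

Lemma eq_qform_all (Y : Type) (P : pred Y) (K K' : Y -> Y -> R) (l : seq (R * Y)) :
  all (fun p => P p.2) l -> (forall x y, P x -> P y -> K x y = K' x y) -> qform K l = qform K' l.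
Proof.
move=> Pl KK'; rewrite /qform -(all_filterP Pl) !big_filter; apply: eq_bigr => p Pp.
by rewrite !big_filter; apply: eq_bigr => q Pq; rewrite KK'.
Qed.

Lemma eq_qform (Y : eqType) (K K' : Y -> Y -> R) (l : seq (R * Y)) :
  {in map snd l &, forall x y, K x y = K' x y} -> qform K l = qform K' l.
Proof.
move=> KK'; apply: (eq_qform_all (P := mem (map snd l))) => //.
by apply/allP=> p pl; exact: map_f.
Qed.

(* A kernel taking the value 1 within the sides of a wall and a across it is
   the convex combination a + (1 - a) (1_h 1_h + 1_h^c 1_h^c). *)
Lemma wall_kernel_pos_def (X : choiceType) (s : seq (R * {fset X})) :
  all (fun ah => 0 <= ah.1 <= 1) s ->
  pos_def (fun x y : X => \prod_(ah <- s) (if (x \in ah.2) == (y \in ah.2) then 1 else ah.1)).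
Proof.
elim: s => [_|[a h] s IH /= /andP[/andP[a0 a1] /IH {}IH]] l.
  rewrite (@eq_qform _ _ (fun _ _ => 1)); last by move=> x y _ _; rewrite big_nil.
  have -> : qform (fun _ _ => 1) l = (\sum_(p <- l) p.1) ^+ 2.
    rewrite /qform expr2 mulr_suml; apply: eq_bigr => p _; rewrite mulr_sumr.
    by apply: eq_bigr => q _; rewrite mulr1.
  exact: sqr_ge0.
pose K x y := \prod_(ah <- s) (if (x \in ah.2) == (y \in ah.2) then 1 else ah.1).
pose c b (x : X) : R := ((x \in h) == b)%:R.
rewrite (@eq_qform _ _ (fun x y => a * K x y + (1 - a) * ((c true x * c true y * K x y) +
   c false x * c false y * K x y))); last first.
  move=> x y _ _; rewrite big_cons /= -/(K x y) /c.
  by case: (x \in h); case: (y \in h) => /=; ring.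
rewrite qformD !qformZ qformD -!qform_scale.
by rewrite addr_ge0 // mulr_ge0 ?subr_ge0 // ?addr_ge0 //; apply: IH.
Qed.

Variables (X : choiceType) (d : X -> X -> R) (mu : X -> X -> X -> X).
Hypotheses (mu_median : median_algebra mu) (d_metric : is_metric d).

(** Each wall occurs twice among the halfspaces, as [h] and as its complement, whence half the
    weight. In this symmetric form the exponential becomes a product of wall kernels. *)
Lemma dM_walls (M : {fset X}) x y : x \in M -> y \in M ->
  dM d mu M x y = \sum_(h <- fpowerset M | halfspace mu M h)
     (if (x \in h) == (y \in h) then 0 else lambda_max d mu M h / 2).
Proof.
move=> xM yM; have -> : dM d mu M x y = (dM d mu M x y + dM d mu M y x) / 2.
  by rewrite (dMC mu d_metric M y x); lra.
rewrite !dME // [in LHS]big_mkcondr /= [X in _ + X]big_mkcondr /= -big_split /= mulr_suml.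
apply: eq_bigr => h _; by case: (x \in h); case: (y \in h) => /=; rewrite ?addr0 ?add0r ?mul0r.
Qed.

Lemma dM_kernel (M : {fset X}) t (l : seq (R * X)) : 0 <= t -> {subset map snd l <= M} ->
  0 <= qform (fun x y => expR (- (t * dM d mu M x y))) l.
Proof.
move=> t0 lM.
pose s := [seq (expR (- (t * (lambda_max d mu M h / 2))), h) | h <- fpowerset M & halfspace mu M h].
rewrite (@eq_qform _ _ (fun x y => \prod_(ah <- s) (if (x \in ah.2) == (y \in ah.2) then 1 else ah.1))).
  apply: wall_kernel_pos_def; apply/allP=> _ /mapP[h _ ->] /=.
  by rewrite expR_ge0 expR_le1 oppr_le0 mulr_ge0 // divr_ge0 // lambda_max_ge0.
move=> x y /lM xM /lM yM; rewrite dM_walls // /s big_map big_filter /=.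
rewrite mulr_sumr -sumrN expR_sum; apply: eq_bigr => h _.
by case: ifP => //= _; rewrite mulr0 oppr0 expR0.
Qed.

Variable L : R.
Hypothesis dL : forall x y, (d_mu d mu x y <= (L * d x y)%:E)%E.

Lemma expRN_lipschitz (a b : R) : 0 <= a -> 0 <= b ->
  `|expR (- a) - expR (- b)| <= `|a - b|.
Proof.
move=> a0 b0; wlog ab : a b a0 b0 / a <= b.
  by move=> W; have [ab|/ltW ba] := leP a b; [exact: W|rewrite distrC [leRHS]distrC; exact: W].
rewrite ger0_norm ?subr_ge0 ?ler_expR ?lerN2 // distrC ger0_norm ?subr_ge0 //.
have -> : expR (- b) = expR (- a) * expR (a - b) by rewrite -expRD; congr expR; ring.
have ea : expR (- a) <= 1 by rewrite expR_le1 oppr_le0.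
have := expR_ge1Dx (a - b); have := expR_ge0 (- a); have : expR (a - b) <= 1 by rewrite expR_le1 subr_le0.
move=> ? ? ?; nra.
Qed.

Lemma delta_kernel_pos_def t : 0 <= t -> pos_def (fun x y => expR (- (t * delta d mu x y))).
Proof.
move=> t0 l; rewrite leNgt; apply/negP => neg.
pose C := \sum_(p <- l) \sum_(q <- l) `|p.1| * `|q.1|.
have C0 : 0 <= C by do 2!(apply: sumr_ge0 => ? _); rewrite mulr_ge0.
set Q := qform _ l in neg.
(* Passing to a finite subalgebra changes the form by at most [t * e * C], which is at most
   [- Q / 2]; a negative [Q] would leave a negative form there. *)
pose e := - Q / (2 * (t * C + 1)).
have tC : 0 < t * C + 1 by rewrite ltr_wpDl // mulr_ge0.
have e0 : 0 < e by rewrite divr_gt0 ?oppr_gt0 // mulr_gt0.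
have [M [sM lM MP]] := delta_approx mu_median d_metric dL (map snd l) e0.
have pM := dM_kernel t0 lM.
have : qform (fun x y => expR (- (t * dM d mu M x y))) l - Q <= t * e * C.
  rewrite /Q /qform -sumrB /C mulr_sumr big_seq [leRHS]big_seq; apply: ler_sum => p pl.
  rewrite -sumrB mulr_sumr big_seq [leRHS]big_seq; apply: ler_sum => q ql.
  rewrite -mulrBr; apply: le_trans (ler_norm _) _; rewrite !normrM [leRHS]mulrC.
  apply: ler_wpM2l; first by rewrite mulr_ge0.
  have d0 := delta_ge0 mu_median d_metric dL p.2 q.2.
  apply: le_trans (expRN_lipschitz _ _) _; rewrite ?mulr_ge0 ?dM_ge0 //.
  rewrite -mulrBr normrM (ger0_norm t0) ler_wpM2l // distrC ger0_norm.
    by have := MP p.2 q.2 (map_f _ pl) (map_f _ ql); lra.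
  by rewrite subr_ge0; exact: (dM_le_delta dL).
have eE : e * (2 * (t * C + 1)) = - Q by rewrite /e divfK // gt_eqF // mulr_gt0.
nra.
Qed.

End Kernel.

(** * Limits along finite subalgebras *)

Section LimitFunction.
Local Open Scope classical_set_scope.
Variables (R : realType) (X : choiceType) (d : X -> X -> R) (mu : X -> X -> X -> X).
Hypotheses (mu_median : median_algebra mu) (d_metric : is_metric d).
Variable L : R.
Hypothesis dL : forall x y, (d_mu d mu x y <= (L * d x y)%:E)%E.
Variable N : nat.
Hypothesis rkN : forall M n, subalgebra mu M -> has_cube mu M n -> (n <= N)%N.

Lemma bounded_ultralimit (T : Type) (G : set_system T) (u : T -> R) (c : R) :
  UltraFilter G -> G [set i | `|u i| <= c] ->
  exists l : R, forall e : R, 0 < e -> G [set i | `|u i - l| < e].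
Proof.
move=> UG Gc; have PG : ProperFilter (u @ G) by exact: fmap_proper_filter.
have [|l [_ ul]] := @segment_compact R (- c) c (u @ G) PG.
  suff : G [set i | u i \in `[- c, c]%R] by [].
  by apply: filterS Gc => i /=; rewrite in_itv /= ler_norml.
exists l => e e0; have [//|nS] := in_ultra_setVsetC [set i | `|u i - l| < e] UG.
have [||r [/= nr]] := ul [set r | ~ `|r - l| < e] [set r | `|r - l| < e].
- exact: nS.
- by apply/nbhs_ballP; exists e => //= r; rewrite /ball /= distrC.
- by move=> ?.
Qed.

(* Ultralimit over finite subalgebras of the functions attached to heavy chains of walls. *)
Lemma limit_function x y : exists f : X -> R,
  [/\ interval_monotone mu (fun _ => True) f, forall p q, f p - f q <= delta d mu p q &
      delta d mu x y <= N%:R * (f y - f x)].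
Proof.
have fex (M : {fset X}) : exists f : X -> R, subalgebra mu M -> x \in M -> y \in M ->
   [/\ interval_monotone mu (fun a => a \in M) f,
    forall p q, p \in M -> q \in M -> f p - f q <= dM d mu M q p, f x = 0 &
    dM d mu M x y <= N%:R * f y].
  have [[sM xM yM]|no] := pselect [/\ subalgebra mu M, x \in M & y \in M].
    by have [f fP] := chain_function mu_median d_metric rkN sM xM yM; exists f.
  by exists (fun=> 0) => sM xM yM; case: no.
have [phi phiP] := choice fex.
(* The filter of properties that hold for all large enough finite subalgebras; directedness gives
   closure under intersection. *)
pose F : set_system {fset X} := fun P => exists M0 : {fset X}, subalgebra mu M0 /\
  forall M : {fset X}, subalgebra mu M -> {subset M0 <= M} -> P M.
have PF : ProperFilter F.
  split; first by move=> [M0 [sM0 /(_ M0 sM0)]]; apply.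
  split.
  - by exists fset0; split=> // a b c; rewrite in_fset0.
  - move=> P Q [M1 [sM1 P1]] [M2 [sM2 Q2]].
    have [M0 [sM0 M10 M20]] := subalgebra_directed mu_median M2 sM1.
    exists M0; split=> // M sM M0M; split; [apply: P1|apply: Q2] => // a.
      by move/M10/M0M.
    by move/M20/M0M.
  - by move=> P Q PQ [M0 [sM0 P0]]; exists M0; split=> // M sM M0M; apply/PQ/P0.
have [G [UG FG]] := ultraFilterLemma PF.
have GF (s : seq X) : G [set M : {fset X} | [/\ subalgebra mu M, x \in M, y \in M & {subset s <= M}]].
  apply: FG; have [M0 [sM0 xys]] := subalgebra_gen mu_median [:: x, y & s].
  exists M0; split=> // M sM M0M; split=> //.
  - by apply/M0M/xys; rewrite inE eqxx.
  - by apply/M0M/xys; rewrite !inE eqxx orbT.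
  - by move=> a sa; apply/M0M/xys; rewrite !inE sa !orbT.
have GM (M : {fset X}) (s : seq X) : [/\ subalgebra mu M, x \in M, y \in M & {subset s <= M}] ->
    forall p q, p \in s -> q \in s -> phi M p - phi M q <= delta d mu p q.
  move=> [sM xM yM sub] p q /sub pM /sub qM; have [_ lip _ _] := phiP M sM xM yM.
  by rewrite (deltaC mu_median d_metric dL); apply: le_trans (lip p q pM qM) (dM_le_delta dL _ _ sM).
have lim p : exists l : R, forall e : R, 0 < e -> G [set M | `|phi M p - l| < e].
  apply: (bounded_ultralimit (c := delta d mu p x)); apply: filterS (GF [:: p; x]) => M MP.
  have [sM xM yM sub] := MP; have [_ _ x0 _] := phiP M sM xM yM; rewrite /= ler_norml.
  have := GM M [:: p; x] MP p x; have := GM M [:: p; x] MP x p.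
  rewrite !inE !eqxx !orbT x0 (deltaC mu_median d_metric dL x) => /(_ isT isT) ? /(_ isT isT) ?.
  by apply/andP; split; lra.
have [f fP] := choice lim.
have approx (s : seq X) (e : R) : 0 < e -> exists M : {fset X},
   [/\ subalgebra mu M, x \in M, y \in M & {subset s <= M}] /\
    forall p, p \in s -> `|phi M p - f p| < e.
  move=> e0; suff : G [set M : {fset X} | [/\ subalgebra mu M, x \in M, y \in M & {subset s <= M}] /\
    forall p, p \in s -> `|phi M p - f p| < e] by move/filter_ex.
  apply: filterI; first exact: GF.
  elim: s => [|p s IH]; first by apply: filterS filterT => M _ p; rewrite in_nil.
  apply: filterS2 (fP p e e0) IH => M pe se q; rewrite inE => /orP[/eqP->//|]; exact: se.
exists f; split.
- move=> u v z _ _ _ zE.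
  have W e : 0 < e -> Num.min (f u) (f v) - e * 2 <= f z <= Num.max (f u) (f v) + e * 2.
    move=> e0; have [M [[sM xM yM sub] sP]] := approx [:: u; v; z] e e0.
    have [mono _ _ _] := phiP M sM xM yM.
    have [us vs zs] : [/\ u \in [:: u; v; z], v \in [:: u; v; z] & z \in [:: u; v; z]].
      by rewrite !inE !eqxx !orbT.
    have := mono u v z (sub _ us) (sub _ vs) (sub _ zs) zE.
    have := sP u us; have := sP v vs; have := sP z zs.
    rewrite !ltr_norml ge_min le_max => /andP[? ?] /andP[? ?] /andP[? ?] /andP[/orP l /orP r].
    apply/andP; split.
      by rewrite lerBlDr ge_min; case: l => ?; apply/orP; [left|right]; lra.
    by rewrite -lerBlDr le_max; case: r => ?; apply/orP; [left|right]; lra.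
  apply/andP; split; apply/ler_addgt0Pr => e e0; have /W/andP[] : 0 < e / 2 by rewrite divr_gt0.
    by move=> ? _; lra.
  by move=> _ ?; lra.
- move=> p q; apply/ler_addgt0Pr => e e0.
  have [|M [MP sP]] := approx [:: p; q] (e / 2); first by rewrite divr_gt0.
  have [ps qs] : p \in [:: p; q] /\ q \in [:: p; q] by rewrite !inE !eqxx !orbT.
  have := GM M _ MP p q ps qs; have := sP p ps; have := sP q qs.
  by rewrite !ltr_norml => /andP[? ?] /andP[? ?] ?; lra.
- apply: (@delta_le _ _ d mu mu_median d_metric L dL) => M0 sM0 xM0 yM0; apply/ler_addgt0Pr => e e0.
  have N0 : 0 < (N%:R + 1 : R) by rewrite ltr_wpDl.
  (* The values at [x] and [y] move by less than [e'] each, so the error is at most [2 * N * e'];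
     adding 1 covers [N = 0]. *)
  pose e' := e / (2 * (N%:R + 1)).
  have e'0 : 0 < e' by rewrite divr_gt0 // mulr_gt0.
  have [M [[sM xM yM sub] sP]] := approx [:: x, y & enum_fset M0] e' e'0.
  have [_ _ x0 hy] := phiP M sM xM yM.
  have xs : x \in [:: x, y & enum_fset M0] by rewrite inE eqxx.
  have ys : y \in [:: x, y & enum_fset M0] by rewrite !inE eqxx orbT.
  have := sP x xs; have := sP y ys; rewrite !ltr_norml x0 => /andP[? ?] /andP[? ?].
  have MM : {subset M0 <= M} by move=> a aM; apply: sub; rewrite !inE aM !orbT.
  have := dM_mono mu_median d_metric sM0 sM MM xM0 yM0.
  have eE : e' * (2 * (N%:R + 1)) = e by rewrite /e' divfK // gt_eqF // mulr_gt0.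
  have : N%:R * phi M y <= N%:R * (f y - f x + 2 * e') by apply: ler_wpM2l => //; lra.
  by rewrite mulrDr; move: hy eE e'0; set n := N%:R => *; nra.
Qed.

End LimitFunction.

(** * Reproducing kernel Hilbert spaces *)

Section AdditiveBounded.
Variable R : realType.

(** Cauchy's functional equation: [f t - t * f 1] is additive and bounded on the half line, hence
    zero. It supplies the homogeneity of the inner product derived from [sqn]. *)
Lemma additive_bounded_linear (f : R -> R) (C : R) :
  (forall s t, f (s + t) = f s + f t) -> (forall t, 0 <= t <= 1 -> `|f t| <= C) ->
  forall t, f t = t * f 1.
Proof.
move=> fD fC.
have f0 : f 0 = 0 by have := fD 0 0; rewrite addr0; lra.
have fN t : f (- t) = - f t by have := fD t (- t); rewrite subrr f0; lra.
have fn n t : f (n%:R * t) = n%:R * f t.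
  elim: n => [|n IH]; first by rewrite !mul0r f0.
  by rewrite -natr1 !mulrDl !mul1r fD IH.
suff pos t : 0 <= t -> f t = t * f 1.
  move=> t; have [/pos//|/ltW t0] := leP 0 t.
  by rewrite -[t]opprK fN pos ?oppr_ge0 //; ring.
move=> t0.
have bd s : 0 <= s -> `|f s - s * f 1| <= 2 * C.
  move=> s0; have /andP[l r] := truncn_itv s0; set n := Num.truncn s in l r.
  have -> : s = n%:R * 1 + (s - n%:R) by ring.
  have rr : 0 <= s - n%:R <= 1 by rewrite -natr1 in r; apply/andP; split; lra.
  rewrite fD fn mulrDl mulr1 opprD addrACA subrr add0r.
  have := fC _ rr; have := fC 1; rewrite ler01 lexx => /(_ isT); move: rr; set u := s - _.
  move=> /andP[u0 u1] c1 cu; apply: le_trans (ler_normB _ _) _; rewrite normrM (ger0_norm u0).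
  have := normr_ge0 (f 1); nra.
apply/eqP; rewrite -subr_eq0 -normr_le0; apply/ler_addgt0Pr => e e0; rewrite add0r leNgt; apply/negP => lt.
have C0 : 0 <= 2 * C by apply: le_trans (bd 0 (lexx _)).
have /andP[_ r] := truncn_itv (divr_ge0 C0 (ltW e0)); set n := Num.truncn _ in r.
have := bd (n.+1%:R * t) (mulr_ge0 (ler0n _ _) t0).
rewrite fn -mulrA -mulrBr normrM normr_nat leNgt => /negP; apply.
rewrite ltr_pdivrMr // in r; apply: lt_trans r _.
by rewrite ltr_pM2l // ltr0n.
Qed.

Lemma real_cauchy (u : nat -> R) :
  (forall e : R, 0 < e -> exists n0, forall m n, (n0 <= m)%N -> (n0 <= n)%N -> `|u m - u n| <= e) ->
  exists l : R, forall e : R, 0 < e -> exists n0, forall n, (n0 <= n)%N -> `|u n - l| <= e.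
Proof.
(* The supremum of the eventual lower bounds is the lower limit of [u]. *)
move=> cu; pose S : set R := fun x => exists n0, forall n, (n0 <= n)%N -> x <= u n.
have key (e : R) : 0 < e -> exists n0, S (u n0 - e) /\ (forall x, S x -> x <= u n0 + e) /\
     forall n, (n0 <= n)%N -> `|u n - u n0| <= e.
  move=> e0; have [n0 n0P] := cu e e0; exists n0; split; [|split].
  - by exists n0 => n nn; have := n0P n n0 nn (leqnn _); rewrite ler_norml => /andP[]; lra.
  - move=> x [n1 n1P]; have := n1P (maxn n0 n1) (leq_maxr _ _).
    have := n0P (maxn n0 n1) n0 (leq_maxl _ _) (leqnn _); rewrite ler_norml => /andP[]; lra.
  - by move=> n nn; apply: n0P.
have hS : has_sup S.
  have [n0 [S0 [Sb _]]] := key 1 ltr01; split; first by exists (u n0 - 1).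
  by exists (u n0 + 1) => x /Sb.
exists (sup S) => e e0; have [|n0 [S0 [Sb nP]]] := key (e / 2); first by rewrite divr_gt0.
exists n0 => n /nP; rewrite !ler_norml => /andP[? ?].
have ? : u n0 - e / 2 <= sup S by apply: ub_le_sup => //; exact: hS.2.
have ? : sup S <= u n0 + e / 2 by apply: ge_sup => //; exact: hS.1.
by apply/andP; split; lra.
Qed.
End AdditiveBounded.

Section RKHS.
Variables (R : realType) (Y : Type) (K : Y -> Y -> R).
Hypotheses (K_pos : pos_def K) (K_sym : forall x y, K x y = K y x).
Implicit Types (f g h : Y -> R) (l : seq (R * Y)).

Definition scal (c : R) l : seq (R * Y) := [seq (c * p.1, p.2) | p <- l].
Definition pairing f l : R := \sum_(p <- l) p.1 * f p.2.
Definition bform l l' : R := \sum_(p <- l) \sum_(q <- l') p.1 * q.1 * K p.2 q.2.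

Lemma bformC l l' : bform l l' = bform l' l.
Proof.
rewrite /bform exchange_big /=; apply: eq_bigr => p _; apply: eq_bigr => q _.
by rewrite K_sym (mulrC q.1).
Qed.

Lemma bform_scal c l l' : bform (scal c l) l' = c * bform l l'.
Proof.
rewrite /bform big_map mulr_sumr; apply: eq_bigr => p _; rewrite mulr_sumr.
by apply: eq_bigr => q _ /=; rewrite !mulrA.
Qed.

Lemma qform_cat l l' : qform K (l ++ l') = qform K l + qform K l' + 2 * bform l l'.
Proof.
rewrite /qform big_cat /=.
have E l1 : \sum_(p <- l1) \sum_(q <- l ++ l') p.1 * q.1 * K p.2 q.2 = bform l1 l + bform l1 l'.
  by rewrite /bform -big_split /=; apply: eq_bigr => p _; rewrite big_cat.
by rewrite !E (bformC l' l) -/(bform l l) -/(bform l' l'); ring.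
Qed.

Lemma qform_scal c l : qform K (scal c l) = c ^+ 2 * qform K l.
Proof. by rewrite -[LHS]/(bform _ _) bform_scal bformC bform_scal mulrA. Qed.

Lemma pairing_cat f l l' : pairing f (l ++ l') = pairing f l + pairing f l'.
Proof. exact: big_cat. Qed.

Lemma pairing_scal f c l : pairing f (scal c l) = c * pairing f l.
Proof.
by rewrite /pairing big_map mulr_sumr; apply: eq_bigr => p _ /=; rewrite mulrA.
Qed.

Lemma pairingD f g l : pairing (f + g) l = pairing f l + pairing g l.
Proof. by rewrite /pairing -big_split; apply: eq_bigr => p _; rewrite fctE mulrDr. Qed.

Lemma pairingN f l : pairing (- f) l = - pairing f l.
Proof. by rewrite /pairing -sumrN; apply: eq_bigr => p _; rewrite fctE mulrN. Qed.

Lemma pairingZ c f l : pairing (c *: f) l = c * pairing f l.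
Proof.
rewrite /pairing mulr_sumr; apply: eq_bigr => p _.
by rewrite fctE /GRing.scale /= mulrCA.
Qed.

(* The squared norm of the reproducing kernel space, as the Legendre transform of
   the quadratic form: |f|^2 = sup_l (2 <f, l> - |l|^2), finite exactly on the space. *)
Definition bounded_by f (C : R) : Prop := forall l, 2 * pairing f l - qform K l <= C.
Definition finite_norm f : Prop := exists C, bounded_by f C.
Definition sqn f : R := sup [set 2 * pairing f l - qform K l | l in [set: seq (R * Y)]]%classic.

Lemma sqn_le f C : bounded_by f C -> sqn f <= C.
Proof.
move=> fC; apply: ge_sup; last by move=> _ [l _ <-].
by exists (2 * pairing f [::] - qform K [::]); exists [::].
Qed.

Lemma sqn_ge f : finite_norm f -> bounded_by f (sqn f).
Proof.
move=> [C fC] l; apply: ub_le_sup; last by exists l.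
by exists C => _ [l' _ <-].
Qed.

Lemma sqn_ge0 f : finite_norm f -> 0 <= sqn f.
Proof.
by move=> /sqn_ge/(_ [::]); rewrite /pairing /qform !big_nil mulr0 subrr.
Qed.

(** Testing on half of [l] puts the factor 1/2 on the form, as the parallelogram identity for the
    forms of [l + l'] and [l - l'] requires. *)
Lemma bounded_by2 f C l : bounded_by f C -> 2 * pairing f l - qform K l / 2 <= 2 * C.
Proof. by move=> /(_ (scal 2^-1 l)); rewrite pairing_scal qform_scal; lra. Qed.

Lemma bounded_byD f g C D : bounded_by f C -> bounded_by g D -> bounded_by (f + g) (2 * C + 2 * D).
Proof.
by move=> /bounded_by2 fC /bounded_by2 gD l; rewrite pairingD; have := fC l; have := gD l; lra.
Qed.

Lemma bounded_byZ c f C : bounded_by f C -> bounded_by (c *: f) (c ^+ 2 * C).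
Proof.
move=> fC l; rewrite pairingZ; have [->|c0] := eqVneq c 0.
  by rewrite mul0r mulr0 expr0n /= mul0r sub0r oppr_le0.
have := fC (scal c^-1 l); rewrite pairing_scal qform_scal => le.
have := ler_wpM2l (sqr_ge0 c) le; suff -> : c ^+ 2 * (2 * (c^-1 * pairing f l) - c^-1 ^+ 2 * qform K l) =
  2 * (c * pairing f l) - qform K l by [].
by field.
Qed.

Lemma finite_normD f g : finite_norm f -> finite_norm g -> finite_norm (f + g).
Proof. by move=> [C fC] [D gD]; exists (2 * C + 2 * D); exact: bounded_byD. Qed.

Lemma finite_normZ c f : finite_norm f -> finite_norm (c *: f).
Proof. by move=> [C fC]; exists (c ^+ 2 * C); exact: bounded_byZ. Qed.

Lemma finite_normN f : finite_norm f -> finite_norm (- f).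
Proof. by rewrite -scaleN1r; exact: finite_normZ. Qed.

Lemma finite_normB f g : finite_norm f -> finite_norm g -> finite_norm (f - g).
Proof. by move=> ff fg; apply: finite_normD => //; exact: finite_normN. Qed.

Lemma finite_norm0 : finite_norm 0.
Proof.
exists 0 => l; have -> : pairing 0 l = 0 by rewrite /pairing big1 // => p _; rewrite mulr0.
by rewrite mulr0 sub0r oppr_le0.
Qed.

Lemma sqnZ c f : finite_norm f -> sqn (c *: f) = c ^+ 2 * sqn f.
Proof.
move=> ff; apply: le_anti; apply/andP; split; first exact/sqn_le/bounded_byZ/sqn_ge.
have [->|c0] := eqVneq c 0.
  by rewrite expr0n /= mul0r scale0r sqn_ge0 //; exact: finite_norm0.
have E : f = c^-1 *: (c *: f) by rewrite scalerA mulVf // scale1r.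
have : sqn f <= c^-1 ^+ 2 * sqn (c *: f).
  by rewrite {1}E; apply/sqn_le/bounded_byZ/sqn_ge/finite_normZ.
by rewrite exprVn -ler_pdivrMl ?invr_gt0 ?exprn_even_gt0 // invrK.
Qed.

(** The test [l] for the sum and [l'] for the difference are traded for [l + l'] against [f] and
    [l - l'] against [g]. The reverse inequality is this one applied to [f + g] and [f - g]. *)
Lemma parallelogram_le f g : finite_norm f -> finite_norm g ->
  sqn (f + g) + sqn (f - g) <= 2 * sqn f + 2 * sqn g.
Proof.
move=> ff fg; rewrite -lerBrDr; apply: sqn_le => l; rewrite lerBrDr addrC -lerBrDr.
apply: sqn_le => l'; rewrite lerBrDr !pairingD pairingN.
have := bounded_by2 (l ++ l') (sqn_ge ff); have := bounded_by2 (l ++ scal (-1) l') (sqn_ge fg).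
rewrite !pairing_cat !qform_cat !pairing_scal qform_scal (bformC l (scal _ _)) bform_scal (bformC l').
lra.
Qed.

Lemma parallelogram f g : finite_norm f -> finite_norm g ->
  sqn (f + g) + sqn (f - g) = 2 * sqn f + 2 * sqn g.
Proof.
move=> ff fg; apply: le_anti; rewrite parallelogram_le //=.
have := parallelogram_le (finite_normD ff fg) (finite_normB ff fg).
have -> : f + g + (f - g) = 2 *: f by rewrite addrACA subrr addr0 scaler_nat.
have -> : f + g - (f - g) = 2 *: g by rewrite opprB addrC addrA subrK scaler_nat.
rewrite !sqnZ //; lra.
Qed.

Definition inner f g : R := (sqn (f + g) - sqn f - sqn g) / 2.

Lemma innerC f g : inner f g = inner g f.
Proof. by rewrite /inner (addrC f g); lra. Qed.

Lemma inner_self f : finite_norm f -> inner f f = sqn f.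
Proof.
move=> ff; rewrite /inner; have -> : f + f = 2 *: f by rewrite scaler_nat.
by rewrite sqnZ //; lra.
Qed.

(** The Jordan-von Neumann argument: additivity is a linear combination of four instances of the
    parallelogram law. *)
Lemma innerDl f g h : finite_norm f -> finite_norm g -> finite_norm h ->
  inner (f + g) h = inner f h + inner g h.
Proof.
move=> ff fg fh.
have := parallelogram (finite_normD ff fg) fh.
have := parallelogram (finite_normD ff fh) fg.
have := parallelogram ff (finite_normB fg fh).
have := parallelogram fg fh.
rewrite /inner (addrA f g (- h)) opprB (addrA f h (- g)) (addrAC f h g) => *; lra.
Qed.

Lemma innerZl c f g : finite_norm f -> finite_norm g -> inner (c *: f) g = c * inner f g.
Proof.
move=> ff fg; have := @additive_bounded_linear R (fun t => inner (t *: f) g) (sqn f + sqn g).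
rewrite scale1r; apply=> [s t|t /andP[t0 t1]].
  by rewrite scalerDl innerDl //; exact: finite_normZ.
have ft := finite_normZ t ff; have p := parallelogram ft fg.
have := sqn_ge0 (finite_normB ft fg); have := sqn_ge0 (finite_normD ft fg).
have := sqnZ t ff; have := sqn_ge0 ff; have := sqn_ge0 fg.
rewrite /inner ler_norml => f0 g0 E a0 b0; have ? : t ^+ 2 * sqn f <= sqn f by rewrite ler_piMl ?exprn_ile1 // sqn_ge0.
by apply/andP; split; lra.
Qed.

(** Continuity of evaluation, obtained by testing the norm on the multiples [t] and [- t] of the
    point mass at [y]; the 1 in the denominator covers [K y y = 0]. *)
Lemma sqn_point f y (e : R) : finite_norm f -> 0 < e -> sqn f <= e ^+ 2 / (K y y + 1) -> `|f y| <= e.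
Proof.
move=> ff e0; have K0 : 0 <= K y y.
  by have := K_pos [:: (1, y)]; rewrite /qform !big_seq1 /= !mul1r.
have K1 : 0 < K y y + 1 by rewrite ltr_wpDl.
set t := e / (K y y + 1); have tE : t * (K y y + 1) = e by rewrite /t divfK // gt_eqF.
have -> : e ^+ 2 / (K y y + 1) = e * t by rewrite /t expr2 mulrA.
have t0 : 0 < t by rewrite divr_gt0.
have := sqn_ge ff [:: (t, y)]; have := sqn_ge ff [:: (- t, y)].
rewrite /pairing /qform !big_seq1 /= => l r; rewrite ler_norml => le.
have ? : t * t * K y y = t * (e - t) by rewrite -tE; ring.
have ? : 0 < t * t by rewrite mulr_gt0.
have l' : t * (- f y) <= t * e by nra.
have r' : t * f y <= t * e by nra.
by move: l' r'; rewrite !ler_pM2l // => ? ?; apply/andP; split; lra.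
Qed.

Lemma sqn_eq0 f : finite_norm f -> sqn f <= 0 -> f = 0.
Proof.
move=> ff f0; apply/funext => y; apply/eqP; rewrite -normr_le0.
apply/ler_addgt0Pr => e e0; rewrite add0r; apply: sqn_point => //.
apply: le_trans f0 _; apply: divr_ge0; first exact: sqr_ge0.
by have := K_pos [:: (1, y)]; rewrite /qform !big_seq1 /= !mul1r => ?; rewrite addr_ge0.
Qed.

Definition kernel_fun l : Y -> R := fun y => \sum_(p <- l) p.1 * K p.2 y.

Lemma pairing_kernel l l' : pairing (kernel_fun l) l' = bform l l'.
Proof.
rewrite /pairing bformC /bform; apply: eq_bigr => p _; rewrite mulr_sumr.
by apply: eq_bigr => q _; rewrite K_sym mulrA.
Qed.

(** This is positivity of the form on the difference of [l] and [l']. *)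
Lemma kernel_fun_bounded l : bounded_by (kernel_fun l) (qform K l).
Proof.
move=> l'; rewrite pairing_kernel; have := K_pos (l ++ scal (-1) l').
rewrite qform_cat qform_scal bformC bform_scal bformC; lra.
Qed.

Lemma kernel_fun_finite l : finite_norm (kernel_fun l).
Proof. by exists (qform K l); exact: kernel_fun_bounded. Qed.

Lemma sqn_kernel l : sqn (kernel_fun l) = qform K l.
Proof.
apply: le_anti; rewrite sqn_le /=; last exact: kernel_fun_bounded.
have := sqn_ge (kernel_fun_finite l) l; rewrite pairing_kernel -/(bform l l).
by rewrite -[qform K l]/(bform l l); lra.
Qed.

(** The limit is pointwise. Each test list involves finitely many points, so the bounds on
    [u m - u n] persist for the limit in place of [u n]. *)
Lemma sqn_complete (u : nat -> Y -> R) : (forall n, finite_norm (u n)) ->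
  (forall e : R, 0 < e -> exists n0, forall m n, (n0 <= m)%N -> (n0 <= n)%N -> sqn (u m - u n) <= e) ->
  exists f, finite_norm f /\
    forall e : R, 0 < e -> exists n0, forall n, (n0 <= n)%N -> sqn (u n - f) <= e.
Proof.
move=> fu cu.
have pt y : exists z : R, forall e : R, 0 < e -> exists n0, forall n, (n0 <= n)%N -> `|u n y - z| <= e.
  apply: real_cauchy => e e0.
  have K0 : 0 < K y y + 1.
    by have := K_pos [:: (1, y)]; rewrite /qform !big_seq1 /= !mul1r => ?; rewrite ltr_wpDl.
  have [|n0 n0P] := cu (e ^+ 2 / (K y y + 1)); first by rewrite divr_gt0 // exprn_gt0.
  exists n0 => m n mm nn; have := @sqn_point (u m - u n) y e (finite_normB (fu m) (fu n)) e0 (n0P m n mm nn).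
  by rewrite !fctE.
have [f fP] := choice pt.
have lim l (e : R) : 0 < e -> exists n0, forall n, (n0 <= n)%N -> `|pairing (u n - f) l| <= e.
  elim: l e => [|p l IH] e e0.
    by exists 0%N => n _; rewrite /pairing big_nil normr0 ltW.
  have c0 : 0 < `|p.1| + 1 by rewrite ltr_wpDl.
  have [|n1 n1P] := fP p.2 (e / 2 / (`|p.1| + 1)); first by rewrite !divr_gt0.
  have [|n2 n2P] := IH (e / 2); first by rewrite divr_gt0.
  exists (maxn n1 n2) => n; rewrite geq_max => /andP[/n1P a /n2P b].
  rewrite /pairing big_cons -/(pairing _ l) !fctE; apply: le_trans (ler_normD _ _) _.
  rewrite normrM; have : `|p.1| * `|u n p.2 - f p.2| <= (`|p.1| + 1) * (e / 2 / (`|p.1| + 1)).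
    by apply: ler_pM => //; rewrite lerDl.
  by rewrite (mulrC (`|p.1| + 1)) divfK ?gt_eqF //; lra.
have bd (e : R) : 0 < e -> exists n0, forall n, (n0 <= n)%N -> bounded_by (u n - f) e.
  move=> e0; have [n0 n0P] := cu e e0; exists n0 => m mm l; apply/ler_addgt0Pr => a a0.
  have [|n1 n1P] := lim l (a / 2); first by rewrite divr_gt0.
  have := n1P _ (leq_maxr n0 n1); rewrite ler_norml => /andP[_ h1].
  have := n0P m _ mm (leq_maxl n0 n1) => h2.
  have := sqn_ge (finite_normB (fu m) (fu (maxn n0 n1))) l.
  move: h1; rewrite !pairingD !pairingN; lra.
exists f; split.
  have [n0 /(_ n0 (leqnn _)) b] := bd 1 ltr01.
  have -> : f = u n0 - (u n0 - f) by rewrite opprB addrC subrK.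
  by apply: finite_normB => //; exists 1.
by move=> e /bd[n0 n0P]; exists n0 => n /n0P; exact: sqn_le.
Qed.

Lemma sqn_pullback (r r' : Y -> Y) f : cancel r r' -> cancel r' r ->
  (forall x y, K (r x) (r y) = K x y) -> finite_norm f ->
  finite_norm (f \o r) /\ sqn (f \o r) = sqn f.
Proof.
have le (s : Y -> Y) g C : (forall x y, K (s x) (s y) = K x y) -> bounded_by g C -> bounded_by (g \o s) C.
  move=> Ks gC l; have := gC [seq (p.1, s p.2) | p <- l].
  rewrite /pairing /qform !big_map.
  by under [X in _ - X <= _ -> _]eq_bigr do rewrite big_map; under [X in _ - X <= _ -> _]eq_bigr do
    under eq_bigr do rewrite /= Ks.
move=> rK r'K Kr ff; have Kr' x y : K (r' x) (r' y) = K x y by rewrite -Kr !r'K.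
have fr : finite_norm (f \o r) by exists (sqn f); apply/le/sqn_ge.
split=> //; apply: le_anti; apply/andP; split; apply: sqn_le; first exact/le/sqn_ge.
have E : f = (f \o r) \o r' by apply/funext => y /=; rewrite r'K.
by rewrite {1}E; apply/le/sqn_ge.
Qed.

End RKHS.

(** * Complexification of the reproducing kernel space *)

Record pd_kernel (R : realType) (Y : Type) := PDKernel {
  kfun :> Y -> Y -> R;
  kpos : pos_def kfun;
  ksym : forall x y, kfun x y = kfun y x }.

Section ComplexRKHS.
Variables (R : realType) (Y : Type) (K : pd_kernel R Y).
Local Notation Re := (@complex.Re R).
Local Notation Im := (@complex.Im R).
Local Notation fin := (finite_norm K).

(** Property (T) speaks of complex Hilbert spaces, whereas the kernels are real; hence the passage
    to pairs of real functions. *)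
Definition cfin : {pred Y -> R[i]} := fun f => `[< fin (Re \o f) /\ fin (Im \o f) >].

Lemma Re_lin (a : R[i]) (f g : Y -> R[i]) :
  Re \o (a *: f + g) = Re a *: (Re \o f) - Im a *: (Im \o f) + (Re \o g).
Proof.
apply/funext => y; rewrite !fctE /= /GRing.scale /=.
by case: a (f y) (g y) => [a b] [c e] [p q].
Qed.

Lemma Im_lin (a : R[i]) (f g : Y -> R[i]) :
  Im \o (a *: f + g) = Re a *: (Im \o f) + Im a *: (Re \o f) + (Im \o g).
Proof.
apply/funext => y; rewrite !fctE /= /GRing.scale /=.
by case: a (f y) (g y) => [a b] [c e] [p q].
Qed.

Lemma cfin_submod : submod_closed cfin.
Proof.
have [p s] := (kpos K, @ksym _ _ K).
split.
  by apply/asboolP; split; exact: finite_norm0.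
move=> a f g /asboolP[fr fi] /asboolP[gr gi]; apply/asboolP.
rewrite Re_lin Im_lin; split; apply: finite_normD => //.
  by apply: finite_normB => //; exact: finite_normZ.
by apply: finite_normD => //; exact: finite_normZ.
Qed.

HB.instance Definition _ := GRing.isSubmodClosed.Build _ _ cfin cfin_submod.

Record rkhs := Rkhs { rfun : Y -> R[i]; rfunP : rfun \in cfin }.
HB.instance Definition _ := [isSub for rfun].
HB.instance Definition _ := [Choice of rkhs by <:].
HB.instance Definition _ := [SubChoice_isSubLmodule of rkhs by <:].

Definition re (v : rkhs) : Y -> R := Re \o rfun v.
Definition im (v : rkhs) : Y -> R := Im \o rfun v.

Lemma re_fin v : fin (re v).
Proof. by have /asboolP[] := rfunP v. Qed.
Lemma im_fin v : fin (im v).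
Proof. by have /asboolP[] := rfunP v. Qed.

Lemma re_lin a u v : re (a *: u + v) = Re a *: re u - Im a *: im u + re v.
Proof. exact: Re_lin. Qed.
Lemma im_lin a u v : im (a *: u + v) = Re a *: im u + Im a *: re u + im v.
Proof. exact: Im_lin. Qed.

Lemma re_sub u v : re (u - v) = re u - re v.
Proof.
have -> : u - v = (-1) *: v + u by rewrite scaleN1r addrC.
by rewrite re_lin /= oppr0 scale0r subr0 scaleN1r addrC.
Qed.
Lemma im_sub u v : im (u - v) = im u - im v.
Proof.
have -> : u - v = (-1) *: v + u by rewrite scaleN1r addrC.
by rewrite im_lin /= oppr0 scale0r addr0 scaleN1r addrC.
Qed.

Definition rip (u v : rkhs) : R[i] :=
  Complex (inner K (re u) (re v) + inner K (im u) (im v))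
  (inner K (im u) (re v) - inner K (re u) (im v)).

Lemma hnorm_rip v : hnorm rip v = Num.sqrt (sqn K (re v) + sqn K (im v)).
Proof.
have [p s] := (kpos K, @ksym _ _ K); have [fr fi] := (re_fin v, im_fin v).
by rewrite /hnorm /= !inner_self.
Qed.

Lemma hnorm_lt v (e : R) : 0 < e -> (hnorm rip v < e) = (sqn K (re v) + sqn K (im v) < e ^+ 2).
Proof.
move=> e0; rewrite hnorm_rip -[X in _ < X]ger0_norm ?(ltW e0) // -sqrtr_sqr.
by rewrite ltr_sqrt // exprn_gt0.
Qed.

Lemma rip_hilbert : is_hilbert rip.
Proof.
have [p s] := (kpos K, @ksym _ _ K).
have fr := re_fin; have fi := im_fin.
have iC := innerC K.
split.
- move=> a u v w.
  have E (x y : R) f1 f2 f3 h : fin f1 -> fin f2 -> fin f3 -> fin h ->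
      inner K (x *: f1 + y *: f2 + f3) h = x * inner K f1 h + y * inner K f2 h + inner K f3 h.
    move=> ? ? ? ?; rewrite !innerDl // ?innerZl //; try exact: finite_normZ.
    by apply: finite_normD => //; exact: finite_normZ.
  rewrite /rip re_lin im_lin -scaleNr !E //.
  case: a => a b /=; apply/eqP; rewrite eq_complex /=.
  by apply/andP; split; apply/eqP; ring.
- move=> u v; apply/eqP; rewrite eq_complex /= (iC (re v)) (iC (im v)) (iC (im v)) (iC (re v)).
  by rewrite opprB !eqxx.
- move=> v; rewrite lecE /= (iC (im v)) subrr eqxx /= !inner_self //.
  by rewrite addr_ge0 // sqn_ge0.
- move=> v /eqP; rewrite eq_complex /= !inner_self // => /andP[/eqP E _].
  have r0 := sqn_ge0 (fr v); have i0 := sqn_ge0 (fi v).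
  have Er : re v = 0 by apply: (sqn_eq0 p) => //; lra.
  have Ei : im v = 0 by apply: (sqn_eq0 p) => //; lra.
  apply: val_inj; apply/funext => y /=; apply/eqP; rewrite eq_complex.
  by have := congr1 (fun h => h y) Er; have := congr1 (fun h => h y) Ei; rewrite /re /im /= => -> ->; rewrite eqxx.
- move=> u cu.
  have cau (f : rkhs -> Y -> R) : (forall v, sqn K (f v) <= sqn K (re v) + sqn K (im v)) ->
     (forall v w, f (v - w) = f v - f w) ->
     forall e : R, 0 < e -> exists n0, forall m n, (n0 <= m)%N -> (n0 <= n)%N ->
       sqn K (f (u m) - f (u n)) <= e.
    move=> fle fB e e0; have [|n0 n0P] := cu (Num.sqrt e); first by rewrite sqrtr_gt0.
    exists n0 => m n mm nn; have := n0P m n mm nn; rewrite hnorm_lt ?sqrtr_gt0 // sqr_sqrtr ?(ltW e0) //.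
    by rewrite -fB => /ltW; apply: le_trans.
  have [|f [ff fP]] := sqn_complete p s (fun n => fr (u n)).
    apply: cau => [v|v w]; last exact: re_sub.
    by rewrite lerDl sqn_ge0.
  have [|g [fg gP]] := sqn_complete p s (fun n => fi (u n)).
    apply: cau => [v|v w]; last exact: im_sub.
    by rewrite lerDr sqn_ge0.
  have lP : (fun y => Complex (f y) (g y)) \in cfin by apply/asboolP; split; [exact: ff|exact: fg].
  exists (Rkhs lP) => e e0.
  have e20 : 0 < e ^+ 2 / 3 by rewrite divr_gt0 // exprn_gt0.
  have [n1 n1P] := fP _ e20; have [n2 n2P] := gP _ e20.
  exists (maxn n1 n2) => n; rewrite geq_max => /andP[/n1P a /n2P b].
  rewrite hnorm_lt // re_sub im_sub.
  have := exprn_gt0 2 e0; move: a b.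
  rewrite -[f]/(re (Rkhs lP)) -[g]/(im (Rkhs lP)); lra.
Qed.

End ComplexRKHS.

(** * Unitary representations from invariant kernels *)

Section PropertyT.
Variables (R : realType) (H : Type) (mul : H -> H -> H) (one : H) (inv : H -> H).
Hypotheses (H_group : is_group mul one inv) (H_T : property_T R mul one inv).
Variables (Y : Type) (K : pd_kernel R Y) (rho : H -> Y -> Y).
Hypotheses (rho1 : forall y, rho one y = y)
  (rhoM : forall g h y, rho (mul g h) y = rho g (rho h y))
  (rhoK : forall g x y, K (rho g x) (rho g y) = K x y).

Lemma rho_invK g : cancel (rho (inv g)) (rho g).
Proof. by case: H_group => _ _ iv y; rewrite -rhoM (iv g).2. Qed.

Lemma rho_Kinv g : cancel (rho g) (rho (inv g)).
Proof. by case: H_group => _ _ iv y; rewrite -rhoM (iv g).1. Qed.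

Lemma pull_cfin g (v : rkhs K) : rfun v \o rho (inv g) \in cfin K.
Proof.
apply/asboolP; split.
  by have [] := sqn_pullback (rho_invK g) (rho_Kinv g) (rhoK (inv g)) (re_fin v).
by have [] := sqn_pullback (rho_invK g) (rho_Kinv g) (rhoK (inv g)) (im_fin v).
Qed.

Definition pull g (v : rkhs K) : rkhs K := Rkhs (pull_cfin g v).

Lemma pull_unitary : unitary_rep (@rip R Y K) mul one pull.
Proof.
have [p s] := (kpos K, @ksym _ _ K).
split.
- by move=> g a u v; apply: val_inj.
- move=> g u v.
  have E f1 f2 : finite_norm K f1 -> finite_norm K f2 ->
      inner K (f1 \o rho (inv g)) (f2 \o rho (inv g)) = inner K f1 f2.
    move=> h1 h2; rewrite /inner.
    have S f : finite_norm K f -> sqn K (f \o rho (inv g)) = sqn K f.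
      by move=> ff; have [_] := sqn_pullback (rho_invK g) (rho_Kinv g) (rhoK (inv g)) ff.
    by rewrite !S // -(S (f1 + f2)) //; exact: finite_normD.
  have fr := @re_fin R Y K; have fi := @im_fin R Y K.
  rewrite /rip -[re (pull g u)]/(re u \o rho (inv g)) -[re (pull g v)]/(re v \o rho (inv g)).
  rewrite -[im (pull g u)]/(im u \o rho (inv g)) -[im (pull g v)]/(im v \o rho (inv g)).
  by rewrite !E.
- move=> v; apply: val_inj; apply/funext => y /=.
  by rewrite -{1}(rho1 (rho (inv one) y)) rho_invK.
- move=> g h v; apply: val_inj; apply/funext => y /=; congr (rfun v _).
  apply: (can_inj (rho_Kinv (mul g h))); rewrite rho_invK rhoM rho_invK rho_invK.
  by [].
Qed.

(** Kernel functions at suitable points are the almost invariant unit vectors. A nonzero invariant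
    vector has a nonzero real or imaginary part, which is an invariant function. *)
Lemma property_T_kernel :
  (forall n (Q : 'I_n -> H) (e : R), 0 < e ->
     exists y, K y y = 1 /\ forall i, 1 - e < K (rho (Q i) y) y) ->
  exists f : Y -> R, [/\ finite_norm K f, forall g y, f (rho g y) = f y & exists y, f y != 0].
Proof.
move=> ai; have [p s] := (kpos K, @ksym _ _ K).
have [|v [v0 vinv]] := H_T (rip_hilbert K) pull_unitary.
  (* The difference of the kernel functions at [y] and at a translate has squared norm
     [2 - 2 * K (rho g y) y], hence the tolerance. *)
  move=> n Q e e0; have [|y [Ky yP]] := ai n Q (e ^+ 2 / 2); first by rewrite divr_gt0 // exprn_gt0.
  have kP : (fun z => (K y z)%:C%C) \in cfin K.
    apply/asboolP; split; last exact: (finite_norm0 p).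
    have -> : complex.Re (R:=R) \o (fun z => (K y z)%:C%C) = kernel_fun K [:: (1, y)].
      by apply/funext => z; rewrite /kernel_fun big_seq1 /= mul1r.
    exact: kernel_fun_finite.
  exists (Rkhs kP).
  have rE : re (Rkhs kP) = kernel_fun K [:: (1, y)].
    by apply/funext => z; rewrite /kernel_fun big_seq1 /= mul1r.
  have iE : im (Rkhs kP) = 0 by [].
  have N0 : sqn K 0 = 0.
    by have := sqnZ p s 0 (finite_norm0 p); rewrite scale0r expr0n mul0r.
  split.
    rewrite hnorm_rip rE iE N0 addr0 sqn_kernel // /qform !big_seq1 /= Ky !mulr1.
    by rewrite sqrtr1.
  move=> i; rewrite hnorm_lt // re_sub im_sub iE rE.
  have -> : im (pull (Q i) (Rkhs kP)) - 0 = 0 by rewrite subr0.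
  have -> : re (pull (Q i) (Rkhs kP)) - kernel_fun K [:: (1, y)] =
      kernel_fun K [:: (1, rho (Q i) y); (-1, y)].
    apply/funext => z; rewrite !fctE /kernel_fun !big_cons !big_nil /= /re /=.
    by rewrite -{1}(rhoK (Q i)) rho_invK; ring.
  rewrite N0 addr0 sqn_kernel // /qform !big_cons !big_nil /= rhoK Ky (s y).
  have := yP i; lra.
have [y fy] : exists y, rfun v y != 0.
  apply: contrapT => no; apply: v0; apply: val_inj; apply/funext => y /=.
  by apply/eqP/negPn/negP => h; apply: no; exists y.
have finv g z : rfun v (rho g z) = rfun v z.
  by have := congr1 (fun w => rfun w (rho g z)) (vinv g); rewrite /= rho_Kinv => ->.
have [r0|r0] := eqVneq (re v y) 0.
  exists (im v); split; [exact: im_fin|by move=> g z; rewrite /im /= finv|].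
  exists y; apply: contra fy => /eqP i0; rewrite eq_complex.
  by move: r0 i0; rewrite /re /im /= => -> ->; rewrite eqxx.
exists (re v); split; [exact: re_fin|by move=> g z; rewrite /re /= finv|by exists y].
Qed.

End PropertyT.

(** * Property (T) bounds orbits *)

Section BoundedOrbit.
Variables (R : realType) (H : Type) (mul : H -> H -> H) (one : H) (inv : H -> H).
Hypotheses (H_group : is_group mul one inv) (H_T : property_T R mul one inv).
Variable D : H -> H -> R.
Hypotheses (D_ge0 : forall g h, 0 <= D g h) (Dxx : forall g, D g g = 0)
  (DC : forall g h, D g h = D h g) (DT : forall a b c, D a c <= D a b + D b c)
  (D_inv : forall k g h, D (mul k g) (mul k h) = D g h)
  (D_pos : forall t : R, 0 <= t -> pos_def (fun g h => expR (- (t * D g h)))).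

Let E (n : nat) (g h : H) : R := expR (- (n.+1%:R^-1 * D g h)).

(** A block diagonal kernel: its reproducing space is the Hilbert sum over [n] of those of [E n]. *)
Definition level_kernel (x y : H * nat) : R := if x.2 == y.2 then E x.2 x.1 y.1 else 0.

Lemma level_kernel_pos_def : pos_def level_kernel.
Proof.
move=> l; have [B Bl] : exists B, all (fun p : R * (H * nat) => (p.2.2 < B)%N) l.
  elim: l => [|p l [B Bl]]; first by exists 0%N.
  exists (maxn p.2.2.+1 B); rewrite /= leq_maxl /=; apply: sub_all Bl => q /=.
  by rewrite leq_max orbC => ->.
pose a n (x : H * nat) : R := (x.2 == n)%:R.
have -> : qform level_kernel l =
    \sum_(0 <= n < B) qform (fun x y => a n x * a n y * E n x.1 y.1) l.
  transitivity (qform (fun x y => \sum_(0 <= n < B) a n x * a n y * E n x.1 y.1) l).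
    apply: (eq_qform_all (P := fun x : H * nat => (x.2 < B)%N)) => // x y xB yB; rewrite /level_kernel.
    rewrite (bigD1_seq x.2) /= ?mem_index_iota ?iota_uniq // big1 ?addr0 => [|n nx].
      by rewrite /a eqxx mul1r eq_sym; case: eqP => _; rewrite ?mul1r ?mul0r.
    by rewrite /a eq_sym (negPf nx) !mul0r.
  elim: B {Bl} => [|B IH].
    by rewrite big_nil /qform big1 // => p _; rewrite big1 // => q _; rewrite big_nil mulr0.
  rewrite big_nat_recr //= -IH -qformD; congr (qform _ l); apply/funext => x; apply/funext => y.
  by rewrite big_nat_recr.
apply: sumr_ge0 => n _; rewrite -(qform_scale (fun x y => E n x.1 y.1)); set l' := map _ l.
have := @D_pos n.+1%:R^-1 _ [seq (p.1, p.2.1) | p <- l'].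
rewrite /qform big_map invr_ge0 ler0n => /(_ isT).
by under eq_bigr do rewrite big_map.
Qed.

Lemma level_kernel_sym x y : level_kernel x y = level_kernel y x.
Proof. by rewrite /level_kernel eq_sym; case: eqP => // ->; rewrite /E DC. Qed.

(** A point far from the identity is far from every point of a finite list, and [exp (- u) <= 1 / u]
    makes each term small. *)
Lemma E_sum_small n (s : seq H) (e : R) : 0 < e ->
  exists C : R, forall g, C <= D g one -> \sum_(h <- s) E n g h <= e.
Proof.
elim: s e => [|h s IH] e e0; first by exists 0 => g _; rewrite big_nil ltW.
have e2 : 0 < e / 2 by rewrite divr_gt0.
have [C CP] := IH _ e2; pose T := n.+1%:R / (e / 2).
exists (Num.max C (D h one + T)) => g; rewrite ge_max => /andP[/CP le hT].
rewrite big_cons; suff : E n g h <= e / 2 by lra.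
have T1 : T <= D g h by have := DT g h one; lra.
have n0 : 0 < n.+1%:R :> R by rewrite ltr0n.
have : (e / 2)^-1 <= n.+1%:R^-1 * D g h.
  by rewrite ler_pdivlMl //; apply: le_trans T1; rewrite /T.
set u := _ * D g h => le'; rewrite /E expRN -[leRHS]invrK lef_pV2 ?posrE ?expR_gt0 ?invr_gt0 //.
by apply: le_trans le' _; apply: le_trans (expR_ge1Dx u); rewrite lerDr.
Qed.

Lemma property_T_bounded : exists C : R, forall g, D g one <= C.
Proof.
case: (H_group) => mA m1 mV.
pose rho g (x : H * nat) := (mul g x.1, x.2).
have [||||f [ff finv [[h n] fh]]] := @property_T_kernel R H mul one inv H_group H_T _
    (PDKernel level_kernel_pos_def level_kernel_sym) rho.
- by case=> g n; rewrite /rho /= (m1 g).1.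
- by move=> g k [x m]; rewrite /rho /= mA.
- by move=> g [x m] [y k]; rewrite /rho /= /level_kernel /= /E D_inv.
- move=> m Q e e0; pose S := \sum_i D (Q i) one; have S0 : 0 <= S by exact: sumr_ge0.
  have /andP[_ r] := truncn_itv (divr_ge0 S0 (ltW e0)); set k := Num.truncn _ in r.
  exists (one, k); rewrite /= /level_kernel /= eqxx /E Dxx mulr0 oppr0 expR0; split=> // i.
  rewrite (m1 (Q i)).2; apply: lt_le_trans (expR_ge1Dx _); rewrite ltrD2l ltrN2.
  have k0 : 0 < k.+1%:R :> R by rewrite ltr0n.
  rewrite ltr_pdivrMl //; rewrite ltr_pdivrMr // in r; apply: le_lt_trans r.
  by rewrite /S (bigD1 i) //= lerDl sumr_ge0.
(* Left translations are transitive on each level. *)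
have f1 g : f (g, n) = f (h, n).
  by rewrite -(finv (mul h (inv g)) (g, n)) /rho /= -mA (mV g).1 (m1 h).2.
apply: contrapT => unb.
have far (s : seq H) (e : R) : 0 < e -> exists g, \sum_(h <- s) E n g h <= e.
  move=> e0; have [C CP] := E_sum_small n s e0; apply: contrapT => no; apply: unb.
  exists C => g; rewrite leNgt; apply/negP => lt; apply: no; exists g; exact/CP/ltW.
(* Each new point costs 1 on the diagonal and at most 1/2 in each of the two off-diagonal sums. *)
have sep m : exists s : seq H, size s = m /\ \sum_(g <- s) \sum_(h <- s) E n g h <= 2 * m%:R.
  elim: m => [|m [s [sm sE]]]; first by exists [::]; rewrite big_nil mulr0.
  have [g gE] := far s 2^-1 ltac:(by rewrite invr_gt0).
  exists (g :: s); rewrite /= sm; split=> //; rewrite big_cons big_cons.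
  under [X in _ + X <= _]eq_bigr do rewrite big_cons.
  rewrite big_split /= {1}/E Dxx mulr0 oppr0 expR0.
  under [X in _ + (X + _) <= _]eq_bigr do rewrite /E DC -/(E _ _ _).
  by rewrite -[m.+1]addn1 natrD; lra.
set c := f (h, n) in fh f1.
have c0 : 0 < c ^+ 2 by rewrite exprn_even_gt0.
(* Testing the norm on [m] such points with weight [c / 2] gives at least
   [c ^+ 2 * m - c ^+ 2 * m / 2]. *)
have key m : m%:R * c ^+ 2 <= 2 * sqn level_kernel f.
  have [s [sm sE]] := sep m.
  have := sqn_ge ff [seq (c / 2, (g, n)) | g <- s]; rewrite /pairing /qform !big_map /=.
  under eq_bigr do rewrite f1; rewrite big_const_seq count_predT iter_addr addr0 sm.
  have -> : \sum_(g <- s) \sum_(q <- [seq (c / 2, (g, n)) | g <- s])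
      c / 2 * q.1 * level_kernel (g, n) q.2 = (c / 2) ^+ 2 * \sum_(g <- s) \sum_(h <- s) E n g h.
    rewrite mulr_sumr; apply: eq_bigr => g _; rewrite big_map mulr_sumr; apply: eq_bigr => k _.
    by rewrite /level_kernel /= eqxx.
  have := ler_wpM2l (sqr_ge0 (c / 2)) sE; rewrite -[_ *+ m]mulr_natr => W V.
  have E1 : (c / 2) ^+ 2 * (2 * m%:R) = c ^+ 2 * m%:R / 2 by field.
  have E2 : 2 * (c / 2 * c * m%:R) = c ^+ 2 * m%:R by field.
  by rewrite mulrC; lra.
have /andP[_ r] := truncn_itv (divr_ge0 (mulr_ge0 (ler0n R 2) (sqn_ge0 ff)) (ltW c0)).
by rewrite ltr_pdivrMr // ltNge key in r.
Qed.

End BoundedOrbit.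

(** * Fixed points in complete connected median spaces *)

Section CompleteMedianSpace.
Variables (R : realType) (X : choiceType) (mu : X -> X -> X -> X) (dist : X -> X -> R).
Hypothesis mu_median : median_algebra mu.
Hypotheses (dist_ge0 : forall x y, 0 <= dist x y)
  (distC : forall x y, dist x y = dist y x) (dist_eq0 : forall x y, dist x y <= 0 -> x = y)
  (distT : forall x y z, dist x z <= dist x y + dist y z)
  (dist_btw : forall x y z, mu x y z = z -> dist x y = dist x z + dist z y).

Definition dist_closed (A : X -> Prop) : Prop :=
  forall z, (forall e : R, 0 < e -> exists w, A w /\ dist z w <= e) -> A z.

Definition monotone_lipschitz (f : X -> R) : Prop :=
  interval_monotone mu (fun _ => True) f /\ forall p q, f p - f q <= dist p q.
Local Notation Phi := monotone_lipschitz.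
Local Notation convex := (mconvex mu (fun _ => True)).

Hypothesis dist_complete : forall u : nat -> X,
  (forall e : R, 0 < e -> exists n0, forall m n, (n0 <= m)%N -> (n0 <= n)%N -> dist (u m) (u n) <= e) ->
  exists l, forall e : R, 0 < e -> exists n0, forall n, (n0 <= n)%N -> dist (u n) l <= e.

Definition halfpow (k : nat) : R := 2^-1 ^+ k.

Lemma halfpow_gt0 k : 0 < halfpow k.
Proof. by rewrite exprn_gt0 // invr_gt0. Qed.

Lemma half_pow_small (C e : R) : 0 < e -> exists n0, forall n, (n0 <= n)%N -> C * halfpow n <= e.
Proof.
move=> e0; have Ce0 : 0 <= `|C| / e by rewrite divr_ge0 // ltW.
have /andP[_ r] := truncn_itv Ce0; set k := Num.truncn _ in r; exists k.+1 => n kn.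
have p0 : 0 < 2 ^+ n :> R by rewrite exprn_gt0.
rewrite /halfpow exprVn ler_pdivrMr // mulrC; apply: le_trans (ler_norm C) _.
rewrite ltr_pdivrMr // in r; apply: le_trans (ltW r) _; apply: ler_wpM2r; first exact: ltW.
by rewrite -natrX ler_nat; apply: leq_trans kn _; apply: ltnW; exact: ltn_expl.
Qed.

(** As in the projection theorem for Hilbert spaces, nearly nearest points to [x0] in finite
    intersections form a Cauchy sequence: for [a] and [b] in a convex set, [mu x0 a b] is in the set
    and lies between [x0] and each of them. *)
Lemma helly_complete (I : Type) (C : I -> X -> Prop) (i0 : I) (x0 : X) (B : R) :
  (forall i, convex (C i)) -> (forall i, dist_closed (C i)) ->
  (forall i j, exists x, C i x /\ C j x) -> (forall x, C i0 x -> dist x0 x <= B) ->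
  exists x, forall i, C i x.
Proof.
move=> cC clC meet Bd.
(* Positions out of range default to [i0], so every finite intersection, even the one for empty [F],
   includes the bounded set [C i0]. *)
pose CF (F : seq I) w := forall k, C (nth i0 F k) w.
have CFne F : exists w, CF F w.
  have [||i j|w wP] := @helly X mu mu_median (fun _ => True) (size F) (fun i => C (nth i0 F i)) => //.
  exists w => k; have [kF|Fk] := ltnP k (size F).+1; first exact: (wP (Ordinal kF)).
  by have := wP ord_max; rewrite /= !nth_default // ltnW.
have CF0 F w : CF F w -> dist x0 w <= B.
  by move=> /(_ (size F)); rewrite nth_default // => /Bd.
have CFcat F G w : CF (F ++ G) w -> CF F w /\ CF G w.
  move=> FG; split=> k; last by have := FG (size F + k)%N; rewrite nth_cat ltnNge leq_addr addKn.
  have := FG k; rewrite nth_cat; have [//|Fk _] := ltnP k (size F).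
  have := FG (size F + size G)%N; rewrite nth_cat ltnNge leq_addr addKn.
  by rewrite /= !nth_default.
have CFc F : convex (CF F) by move=> a b c aF bF _ k; apply: cC.
pose S : set R := fun r => exists F, forall w, CF F w -> r <= dist x0 w.
have S0 : S 0 by exists [::].
have SB r : S r -> r <= B by move=> [F rF]; have [w wF] := CFne F; exact: le_trans (rF w wF) (CF0 _ _ wF).
have hS : has_sup S by split; [exists 0|exists B => r /SB].
set rho := sup S.
have good (e : R) : 0 < e -> exists F, forall w, CF F w -> rho - e <= dist x0 w.
  move=> e0; have [r [F rF] lt] := sup_adherent e0 hS; exists F => w /rF; apply: le_trans.
  exact: ltW.
have near F (e : R) : 0 < e -> exists w, CF F w /\ dist x0 w <= rho + e.
  move=> e0; apply: contrapT => no; suff : rho + e <= rho by rewrite gerDl leNgt e0.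
  apply: ub_le_sup; first exact: hS.2.
  by exists F => w wF; rewrite leNgt; apply/negP => lt; apply: no; exists w; split=> //; exact: ltW.
(* The median is at distance at least [rho - e] from [x0], so [a] and [b] are each within [2 * e] of
   it. *)
have close F (e : R) a b : (forall w, CF F w -> rho - e <= dist x0 w) -> CF F a -> CF F b ->
    dist x0 a <= rho + e -> dist x0 b <= rho + e -> dist a b <= 4 * e.
  move=> FP aF bF ae be; have m1 := med_idem mu_median x0 a b.
  have mF : CF F (mu x0 a b) by rewrite (medR mu_median); exact: CFc.
  have m2 : mu x0 b (mu x0 a b) = mu x0 a b by rewrite (medAC mu_median x0 a b) med_idem.
  have m3 : mu a b (mu x0 a b) = mu x0 a b by rewrite (medR mu_median x0 a b) med_idem.
  have := dist_btw m1; have := dist_btw m2; have := dist_btw m3; have := FP _ mF.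
  rewrite (distC a (mu _ _ _)); lra.
have e0 k : 0 < halfpow k  by exact: halfpow_gt0.
have [F FP] := choice (fun k => good _ (e0 k)).
have [z zP] := choice (fun k => near (F k) _ (e0 k)).
have zw k G : exists w, CF G w /\ dist (z k) w <= 4 * halfpow k.
  have [w [/CFcat[wF wG] we]] := near (F k ++ G) _ (e0 k); exists w; split=> //.
  by have [zF ze] := zP k; exact: close (FP k) zF wF ze we.
have zz j k : dist (z j) (z k) <= 4 * halfpow j + 4 * halfpow k.
  have e1 : 0 < Num.min (halfpow j) (halfpow k) :> R by rewrite lt_min !e0.
  have [w [/CFcat[wj wk] we]] := near (F j ++ F k) _ e1.
  have wj' : dist (z j) w <= 4 * halfpow j.
    have [zF ze] := zP j; apply: close (FP j) zF wj ze _.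
    by apply: le_trans we _; rewrite lerD2l ge_min lexx.
  have wk' : dist (z k) w <= 4 * halfpow k.
    have [zF ze] := zP k; apply: close (FP k) zF wk ze _.
    by apply: le_trans we _; rewrite lerD2l ge_min lexx orbT.
  by have := distT (z j) w (z k); rewrite (distC w (z k)); lra.
have [l lP] : exists l, forall e : R, 0 < e -> exists n0, forall n, (n0 <= n)%N -> dist (z n) l <= e.
  apply: dist_complete => e e'; have [|n0 n0P] := half_pow_small 4 (_ : 0 < e / 2); first by rewrite divr_gt0.
  by exists n0 => m n /n0P ? /n0P ?; have := zz m n; lra.
exists l => i; apply: clC => e e'.
have [|n0 n0P] := half_pow_small 4 (_ : 0 < e / 2); first by rewrite divr_gt0.
have [|n1 n1P] := lP (e / 2); first by rewrite divr_gt0.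
have [w [wi we]] := zw (maxn n0 n1) [:: i]; exists w; split; first exact: (wi 0%N).
have := distT l (z (maxn n0 n1)) w; rewrite (distC l (z _)).
have := n0P _ (leq_maxl n0 n1); have := n1P _ (leq_maxr n0 n1); lra.
Qed.

(** The excess in the triangle inequality is twice the distance from [z] to [mu x y z]. The metric
    description shows that intervals are closed. *)
Lemma btwP x y z : mu x y z = z <-> dist x z + dist z y <= dist x y.
Proof.
split=> [/dist_btw->//|le]; apply: dist_eq0.
have m1 := med_idem mu_median x y z.
have m2 : mu x z (mu x y z) = mu x y z by rewrite (medAC mu_median x y z) med_idem.
have m3 : mu y z (mu x y z) = mu x y z by rewrite (medR mu_median x y z) med_idem.
have := dist_btw m1; have := dist_btw m2; have := dist_btw m3.
by rewrite (distC y z) (distC y (mu _ _ _)); lra.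
Qed.

Lemma interval_convex x y : convex (fun z => mu x y z = z).
Proof.
move=> a b c ax bx _; have xyR z : mu z x y = mu x y z by rewrite (medRR mu_median x y).
by rewrite -xyR -[mu a b c in LHS]med_idem // (medRR mu_median a b) medD // !xyR ax bx -(medRR mu_median a b) med_idem.
Qed.

Lemma interval_closed x y : dist_closed (fun z => mu x y z = z).
Proof.
move=> z zP; apply/btwP/ler_addgt0Pr => e e0; have [|w [/btwP wP we]] := zP (e / 2); first by rewrite divr_gt0.
have := distT x w z; have := distT z w y; rewrite (distC w z); lra.
Qed.

Lemma sublevel_convex f t : Phi f -> convex (fun z => f z <= t).
Proof.
move=> [fm _] a b c at_ bt _; have /andP[_] := fm a b (mu a b c) I I I (med_idem mu_median a b c).
by move=> /le_trans; apply; rewrite ge_max at_ bt.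
Qed.

Lemma sublevel_closed f t : Phi f -> dist_closed (fun z => f z <= t).
Proof.
move=> [_ fl] z zP; apply/ler_addgt0Pr => e /zP[w [wt we]]; have := fl z w; lra.
Qed.

Lemma PhiN f : Phi f -> Phi (fun z => - f z).
Proof.
move=> [fm fl]; split=> [u v z Tu Tv Tz /(fm u v z Tu Tv Tz)|p q]; last by rewrite opprK addrC distC.
by rewrite -oppr_max -oppr_min !lerN2 andbC.
Qed.

Definition dinf x y : R := sup [set f y - f x | f in Phi]%classic.

Lemma Phi0 : Phi (fun=> 0).
Proof. by split=> [u v z _ _ _ _|p q]; rewrite ?minxx ?maxxx ?lexx // subrr. Qed.

Lemma dinf_ge f x y : Phi f -> f y - f x <= dinf x y.
Proof.
move=> Pf; apply: ub_le_sup; last by exists f.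
by exists (dist y x) => _ [g [_ gl] <-].
Qed.

Lemma dinf_le x y C : (forall f, Phi f -> f y - f x <= C) -> dinf x y <= C.
Proof.
move=> fC; apply: ge_sup; last by move=> _ [f Pf <-]; exact: fC.
by exists (0 - 0); exists (fun=> 0) => //; exact: Phi0.
Qed.

Lemma dinfC x y : dinf x y = dinf y x.
Proof.
suff le u v : dinf u v <= dinf v u by apply: le_anti; rewrite !le.
by apply: dinf_le => f /PhiN/(dinf_ge v u); lra.
Qed.

Lemma dinf_ge0 x y : 0 <= dinf x y.
Proof. by have := dinf_ge x y Phi0; rewrite subrr. Qed.

Lemma dinf_triangle x y z : dinf x z <= dinf x y + dinf y z.
Proof.
by apply: dinf_le => f Pf; have := dinf_ge x y Pf; have := dinf_ge y z Pf; lra.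
Qed.

Lemma dinf_le_dist x y : dinf x y <= dist x y.
Proof. by apply: dinf_le => f [_ fl]; rewrite distC. Qed.

Hypothesis interval_ivt : forall f z w (c : R), Phi f -> f z <= c <= f w ->
  exists p, mu z w p = p /\ f p = c.

(* If the two sublevel sets were disjoint, truncating and concatenating f and g
   would give a monotone Lipschitz function separating x from y by r + s. *)
Lemma sublevels_meet f g x y (r s : R) : Phi f -> Phi g -> 0 <= r -> 0 <= s -> dinf x y < r + s ->
  exists z, f z <= f x + r /\ g z <= g y + s.
Proof.
move=> Pf Pg r0 s0 lt; apply: contrapT => no; have [fm fl] := Pf; have [gm gl] := Pg.
pose u z := f z - f x; pose w z := s - (g z - g y).
have uw z : u z <= r -> w z < 0.
  rewrite /u /w => uz; rewrite ltNge; apply/negP => wz; apply: no; exists z; split; lra.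
pose chi z := Num.min (u z) r + Num.max 0 (w z).
have chiP z : (u z <= r /\ w z < 0 /\ chi z = u z) \/ (r < u z /\ w z <= 0 /\ chi z = r) \/
              (r < u z /\ 0 < w z /\ chi z = r + w z).
  rewrite /chi; have [uz|uz] := leP (u z) r.
    by left; have := uw z uz; split=> //; split=> //; rewrite max_l ?addr0 // ltW.
  by right; have [wz|wz] := leP (w z) 0; [left|right]; rewrite ?addr0.
have um p q z : mu p q z = z -> (u p <= u z \/ u q <= u z) /\ (u z <= u p \/ u z <= u q).
  move=> /(fm p q z I I I); rewrite ge_min le_max /u => /andP[/orP l /orP h].
  by split; [case: l|case: h] => ?; [left|right|left|right]; lra.
have wm p q z : mu p q z = z -> (w p <= w z \/ w q <= w z) /\ (w z <= w p \/ w z <= w q).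
  move=> /(gm p q z I I I); rewrite ge_min le_max /w => /andP[/orP l /orP h].
  by split; [case: h|case: l] => ?; [left|right|left|right]; lra.
have Pchi : Phi chi.
  split=> [p q z _ _ _ pqz|p q].
    have [ul uh] := um p q z pqz; have [wl wh] := wm p q z pqz.
    have mn a b : u a <= u b -> Num.min (u a) r <= Num.min (u b) r.
      by move=> ab; rewrite le_min !ge_min ab lexx orbT.
    have mx a b : w a <= w b -> Num.max 0 (w a) <= Num.max 0 (w b).
      by move=> ab; rewrite ge_max !le_max ab lexx orbT.
    have wu a : 0 < w a -> r < u a.
      by move=> wa; rewrite ltNge; apply/negP => /uw; rewrite ltNge ltW.
    have up p' q' : u z <= u p' -> w z <= w q' -> chi z <= Num.max (chi p') (chi q').
      move=> zp zq; rewrite le_max; apply/orP; have [wz|wz] := leP (w z) 0; [left|right].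
        by apply: lerD; [exact: mn|rewrite max_l // le_max lexx].
      apply: lerD; last exact: mx.
      by rewrite (min_r (ltW (wu q' (lt_le_trans wz zq)))) ge_min lexx orbT.
    have lo p' q' : u p' <= u z -> w q' <= w z -> Num.min (chi p') (chi q') <= chi z.
      move=> zp zq; rewrite ge_min; apply/orP; have [wz|wz] := leP (w p') 0; [left|right].
        by apply: lerD; [exact: mn|rewrite max_l // le_max lexx].
      apply: lerD; last exact: mx.
      by rewrite (min_r (ltW (lt_le_trans (wu p' wz) zp))) ge_min lexx orbT.
    apply/andP; split.
      case: ul wl => hu [] hw; [|exact: lo|rewrite minC; exact: lo|].
        by have := lo p p hu hw; rewrite minxx ge_min => ->.
      by have := lo q q hu hw; rewrite minxx ge_min orbC => ->.
    case: uh wh => hu [] hw; [|exact: up|rewrite maxC; exact: up|].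
      by have := up p p hu hw; rewrite maxxx le_max => ->.
    by have := up q q hu hw; rewrite maxxx le_max orbC => ->.
  have d0 := dist_ge0 p q; have ul := fl p q; have wl := gl q p; rewrite (distC q p) in wl.
  case: (chiP p) => [[a1 [a2 ->]]|[[a1 [a2 ->]]|[a1 [a2 ->]]]];
  case: (chiP q) => [[b1 [b2 ->]]|[[b1 [b2 ->]]|[b1 [b2 ->]]]]; rewrite /u /w in a1 a2 b1 b2 *; try lra.
  (* The remaining case has [u q <= r] and [0 < w p]. The interval contains [m] with [u m = r],
     where [w] is negative, so the increments of [u] up to [m] and of [w] beyond it add up to at
     most [dist p q]. *)
  have [|m [qpm mE]] := @interval_ivt f q p (f x + r) Pf; first by apply/andP; split; lra.
  have wmm : w m < 0 by apply: uw; rewrite /u mE; lra.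
  have := dist_btw qpm; have := fl m q; have := gl m p; rewrite (distC p q) (distC m q) /w in wmm *; lra.
have := dinf_ge x y Pchi.
have ux : u x = 0 by rewrite /u subrr.
have wy : w y = s by rewrite /w subrr subr0.
have wx := uw x; have uy : r < u y.
  by rewrite ltNge; apply/negP => /uw; rewrite wy; lra.
rewrite ux in wx; have {}wx := wx r0.
have -> : chi x = 0 by rewrite /chi ux min_l // max_l ?addr0 // ltW.
have -> : chi y = r + s by rewrite /chi wy min_r ?max_r // ltW.
by rewrite subr0 leNgt lt.
Qed.

(** A ball of [dinf] is the intersection of sublevel sets of all [g] in [Phi]. The interval from
    [x0] to [x] joins the family as the bounded member that [helly_complete] asks for. *)
Lemma ball_meets_sublevel f x0 x (r s : R) : Phi f -> 0 <= r -> 0 <= s -> dinf x0 x < r + s ->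
  exists z, f z <= f x + s /\ forall g, Phi g -> g z <= g x0 + r.
Proof.
move=> Pf r0 s0 lt.
pose C (i : option (option (X -> R))) z := match i with
  | None => mu x0 x z = z
  | Some None => f z <= f x + s
  | Some (Some g) => Phi g -> g z <= g x0 + r end.
have [||[[g|]|] [[h|]|]|z zx|z zP] := @helly_complete _ C None x0 (dist x0 x).
- case=> [[g|]|] /=; [|exact: sublevel_convex|exact: interval_convex].
  by move=> a b c aC bC Uc Pg; apply: (sublevel_convex Pg); [exact: aC|exact: bC|].
- case=> [[g|]|] /=; [|exact: sublevel_closed|exact: interval_closed].
  move=> z zP Pg; apply: (sublevel_closed Pg) => e /zP[w [wC we]]; exists w; split=> //; exact: wC.
- by exists x0; split=> _; rewrite lerDl.
- have [Pg|nPg] := pselect (Phi g).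
    by have [z [z1 z2]] := sublevels_meet Pg Pf r0 s0 lt; exists z; split=> /=.
  by exists x; split=> //=; rewrite lerDl.
- by exists x0; split=> /= [_|]; rewrite ?lerDl // medxyx.
- have [Pg|nPg] := pselect (Phi h).
    by have [z [z1 z2]] := sublevels_meet Pg Pf r0 s0 lt; exists z; split=> /=.
  by exists x; split=> //=; rewrite lerDl.
- by exists x; split=> /=; rewrite lerDl.
- by exists x; split=> /=; rewrite ?lerDl // medyy.
- by exists x0; split=> /= [|_]; rewrite ?lerDl // medxyx.
- by exists x; split=> /=; rewrite ?lerDl // medyy.
- by exists x; split=> /=; rewrite medyy.
- by rewrite (dist_btw zx) lerDl.
- by exists z; split; [exact: (zP (Some None))|move=> g; exact: (zP (Some (Some g)))].
Qed.

(** The slack [e] provides the strict inequality in [sublevels_meet]. The bounded member of the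
    family is now the full ball about [x0], bounded because [dist] is at most [N * dinf]. *)
Lemma balls_meet (f : X -> R) (x0 : X) (e : R) : 0 < e -> (forall x y, dinf x y <= f x + f y) ->
  forall N : R, (forall x y, dist x y <= N * dinf x y) -> 0 <= N ->
  exists z, forall x, dinf x z <= f x + e.
Proof.
move=> e0 fD N distN N0.
have f0 x : 0 <= f x by have := fD x x; have := dinf_ge0 x x; lra.
have fe x : 0 <= f x + e by rewrite addr_ge0 // ltW.
have lt x y : dinf x y < (f x + e) + (f y + e) by have := fD x y; lra.
pose C (i : option ((X -> R) * X)) z := match i with
  | None => forall g, Phi g -> g z <= g x0 + (f x0 + e)
  | Some gx => Phi gx.1 -> gx.1 z <= gx.1 gx.2 + (f gx.2 + e) end.
have mixed g x : exists z, (Phi g -> g z <= g x + (f x + e)) /\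
    forall h, Phi h -> h z <= h x0 + (f x0 + e).
  have [Pg|nPg] := pselect (Phi g).
    by have [z [z1 z2]] := ball_meets_sublevel Pg (fe x0) (fe x) (lt x0 x); exists z.
  by exists x0; split=> // h _; rewrite lerDl.
have [||[[g x]|] [[h y]|]|z zx|z zP] := @helly_complete _ C None x0 (N * (f x0 + e)).
- case=> [[g x]|] /=.
    by move=> a b c aC bC Uc Pg; apply: (sublevel_convex Pg); [exact: aC|exact: bC|].
  by move=> a b c aC bC Uc g Pg; apply: (sublevel_convex Pg); [exact: aC|exact: bC|].
- case=> [[g x]|] /=.
    move=> z zP Pg; apply: (sublevel_closed Pg) => a /zP[w [wC we]]; exists w; split=> //; exact: wC.
  move=> z zP g Pg; apply: (sublevel_closed Pg) => a /zP[w [wC we]]; exists w; split=> //; exact: wC.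
- have [Pg|nPg] := pselect (Phi g); have [Ph|nPh] := pselect (Phi h).
  + by have [z [z1 z2]] := sublevels_meet Pg Ph (fe x) (fe y) (lt x y); exists z; split=> /=.
  + by exists x; split=> //= _; rewrite lerDl.
  + by exists y; split=> //= _; rewrite lerDl.
  + by exists x; split=> /=.
- by have [z [z1 z2]] := mixed g x; exists z; split=> /=.
- by have [z [z1 z2]] := mixed h y; exists z; split=> /=.
- by exists x0; split=> g _; rewrite lerDl.
- apply: le_trans (distN _ _) _; apply: ler_wpM2l => //.
  by apply: dinf_le => g /zx; lra.
- exists z => x; apply: dinf_le => g Pg; have := zP (Some (g, x)) Pg; rewrite /=; lra.
Qed.

(** * Invariant radius functions of a bounded orbit *)

Variable N : R.
Hypotheses (N_ge0 : 0 <= N) (dist_le_dinf : forall x y, dist x y <= N * dinf x y).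
Variables (H : Type) (act : H -> X -> X) (x0 : X) (Delta : R).
Hypotheses (act_dinf : forall g x y, dinf (act g x) (act g y) = dinf x y)
  (act_inv : forall g, exists g', cancel (act g) (act g') /\ cancel (act g') (act g))
  (act_comp : forall g h, exists k, forall x, act k x = act g (act h x))
  (Delta_gt0 : 0 < Delta)
  (orbit_bounded : forall g, dinf x0 (act g x0) <= Delta)
  (H_inhabited : exists g : H, True).

(** These are the invariant radius functions in Isbell's construction of the injective hull, whose
    points are the extremal ones. *)
Definition admissible (f : X -> R) : Prop :=
  (forall x y, dinf x y <= f x + f y) /\ forall g x, f (act g x) = f x.

(** Measures the failure of extremality; the tolerance [a] is there because the supremum in
    [conjugate] need not be attained. *)
Definition gap (f : X -> R) (e : R) : Prop :=
  forall x a, 0 < a -> exists y, f x + f y <= dinf x y + e + a.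

Definition radius (x : X) : R := sup [set dinf x (act g x0) | g in [set: H]]%classic.

Definition conjugate (f : X -> R) (x : X) : R := sup [set dinf x y - f y | y in [set: X]]%classic.

Lemma conjugate_ge f x y : admissible f -> dinf x y - f y <= conjugate f x.
Proof.
move=> [fD _]; apply: ub_le_sup; last by exists y.
by exists (f x) => _ [z _ <-]; have := fD x z; lra.
Qed.

Lemma conjugate_le f x C : (forall y, dinf x y - f y <= C) -> conjugate f x <= C.
Proof.
move=> fC; apply: ge_sup; last by move=> _ [y _ <-].
by exists (dinf x x0 - f x0); exists x0.
Qed.

Lemma conjugate_le_self f x : admissible f -> conjugate f x <= f x.
Proof. by move=> [fD _]; apply: conjugate_le => y; have := fD x y; lra. Qed.

Lemma conjugate_inv f g x : admissible f -> conjugate f (act g x) = conjugate f x.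
Proof.
move=> af; have le h y : conjugate f (act h y) <= conjugate f y.
  apply: conjugate_le => z; have [h' [hK h'K]] := act_inv h.
  rewrite -(h'K z) act_dinf; case: (af) => _ ->; exact: conjugate_ge.
apply: le_anti; rewrite le /=; have [g' [gK _]] := act_inv g.
by rewrite -{1}(gK x) le.
Qed.

(* Lang's averaging step towards an extremal function: it halves the gap. *)
Definition improve (f : X -> R) (x : X) : R := (f x + conjugate f x) / 2.

Lemma improve_admissible f : admissible f -> admissible (improve f).
Proof.
move=> af; split=> [x y|g x].
  by have := conjugate_ge x y af; have := conjugate_ge y x af; rewrite (dinfC y x) /improve; lra.
by rewrite /improve conjugate_inv //; case: af => _ ->.
Qed.

Lemma improve_le f x : admissible f -> improve f x <= f x.
Proof. by move=> af; have := conjugate_le_self x af; rewrite /improve; lra. Qed.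

Lemma improve_gap f e : admissible f -> gap f e -> gap (improve f) (e / 2).
Proof.
move=> af fg x a a0.
(* Since [f] exceeds its conjugate by at most [e], the average exceeds it by at most [e / 2]. *)
have c1 : f x - e <= conjugate f x.
  apply/ler_addgt0Pr => b b0; have [y yP] := fg x b b0; have := conjugate_ge x y af; lra.
have [y yP] : exists y, conjugate f x - a <= dinf x y - f y.
  apply: contrapT => no; suff : conjugate f x <= conjugate f x - a by lra.
  apply: conjugate_le => y; rewrite leNgt; apply/negP => lt; apply: no; exists y; exact: ltW.
exists y; have := improve_le y af; rewrite {2}/improve; lra.
Qed.

Lemma radius_ge x g : dinf x (act g x0) <= radius x.
Proof.
apply: ub_le_sup; last by exists g.
exists (dinf x x0 + Delta) => _ [h _ <-]; apply: le_trans (dinf_triangle x x0 _) _.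
by rewrite lerD2l.
Qed.

Lemma radius_le x C : (forall g, dinf x (act g x0) <= C) -> radius x <= C.
Proof.
move=> fC; apply: ge_sup; last by move=> _ [g _ <-].
by have [g _] := H_inhabited; exists (dinf x (act g x0)); exists g.
Qed.

Lemma radius_admissible : admissible radius.
Proof.
split=> [x y|g x].
  have [g _] := H_inhabited; have := radius_ge x g; have := radius_ge y g.
  by have := dinf_triangle x (act g x0) y; rewrite (dinfC (act g x0)); lra.
have le h y : radius (act h y) <= radius y.
  apply: radius_le => k; have [h' [hK h'K]] := act_inv h; have [m mP] := act_comp h' k.
  by rewrite -(h'K (act k x0)) act_dinf -mP; exact: radius_ge.
apply: le_anti; rewrite le /=; have [g' [gK _]] := act_inv g.
by rewrite -{1}(gK x) le.
Qed.

(** An orbit point nearly farthest from [x] serves as partner: by invariance the radius at each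
    orbit point is at most [Delta]. *)
Lemma radius_gap : gap radius Delta.
Proof.
move=> x a a0; have [g gP] : exists g, radius x - a <= dinf x (act g x0).
  apply: contrapT => no; suff : radius x <= radius x - a by lra.
  apply: radius_le => g; rewrite leNgt; apply/negP => lt; apply: no; exists g; exact: ltW.
exists (act g x0); suff : radius (act g x0) <= Delta by lra.
case: radius_admissible => _ ->; exact: radius_le.
Qed.

Lemma fixed_point : exists x, forall g, act g x = x.
Proof.
pose F k := iter k improve radius; pose e k : R := Delta * halfpow k.
have FA k : admissible (F k).
  by elim: k => [|k IH]; [exact: radius_admissible|exact: improve_admissible].
have FG k : gap (F k) (e k).
  elim: k => [|k IH]; first by rewrite /e /halfpow expr0 mulr1; exact: radius_gap.
  by have := improve_gap (FA k) IH; rewrite /e /halfpow exprSr mulrA.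
have Fmono j k : (j <= k)%N -> forall x, F k x <= F j x.
  move=> jk x; rewrite -(subnK jk); elim: (k - j)%N => [|i IH] //.
  by rewrite addSn; apply: le_trans IH; exact: improve_le.
have e0 k : 0 < e k by rewrite mulr_gt0 // halfpow_gt0.
have [z zP] := choice (fun k => balls_meet x0 (e0 k) (FA k).1 dist_le_dinf N_ge0).
(* For a partner [y] given by the gap, [F k (z k) + F k y <= dinf (z k) y + 2 * e k], and
   [dinf (z k) y <= F k y + e k] by the choice of [z k]. *)
have Fz k : F k (z k) <= 3 * e k.
  have [y yP] := FG k (z k) (e k) (e0 k); have := zP k y; rewrite dinfC; lra.
have zz j k : (j <= k)%N -> dinf (z j) (z k) <= 3 * e j + 3 * e k.
  move=> jk; have := (FA k).1 (z j) (z k); have := Fmono j k jk (z j).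
  have := Fz j; have := Fz k; lra.
have [l lP] : exists l, forall a : R, 0 < a -> exists n0, forall n, (n0 <= n)%N -> dist (z n) l <= a.
  apply: dist_complete => a a0; have [|n0 n0P] := half_pow_small (N * 3 * Delta) (_ : 0 < a / 2).
    by rewrite divr_gt0.
  have W m n : (n0 <= m)%N -> (m <= n)%N -> dist (z m) (z n) <= a.
    move=> mm mn; apply: le_trans (dist_le_dinf _ _) _.
    apply: le_trans (ler_wpM2l N_ge0 (zz m n mn)) _.
    have := n0P m mm; have := n0P n (leq_trans mm mn); rewrite /e; lra.
  exists n0 => m n mm nn; have [mn|/ltnW nm] := leqP m n; first exact: W.
  by rewrite distC; exact: W.
exists l => g; apply: dist_eq0; apply: le_trans (dist_le_dinf _ _) _.
suff : dinf (act g l) l <= 0 by move=> le; rewrite mulr_ge0_le0.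
apply/ler_addgt0Pr => a a0; rewrite add0r.
(* By invariance of [F n] the point [z n] is moved by at most [2 * F n (z n)], hence by at most
   [6 * e n]. *)
have [|n0 n0P] := half_pow_small (6 * Delta) (_ : 0 < a / 2); first by rewrite divr_gt0.
have [|n1 n1P] := lP (a / 4); first by rewrite divr_gt0.
set n := maxn n0 n1; have h0 := n0P n (leq_maxl _ _); have h1 := n1P n (leq_maxr _ _).
have t1 := dinf_triangle (act g l) (act g (z n)) l; rewrite act_dinf in t1.
have t2 := dinf_triangle (act g (z n)) (z n) l.
have t3 := dinf_le_dist (z n) l; rewrite (dinfC l) in t1.
have := (FA n).1 (act g (z n)) (z n); rewrite (FA n).2; have := Fz n; rewrite /e; lra.
Qed.

End CompleteMedianSpace.

(** * Completeness and intermediate values for [delta] *)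

Section Continuity.
Variables (R : realType) (X : choiceType) (d : X -> X -> R) (mu : X -> X -> X -> X).
Hypotheses (mu_median : median_algebra mu) (d_metric : is_metric d) (mu_cont : continuous3 d mu).
Variable L : R.
Hypotheses (L_ge0 : 0 <= L) (dL : forall x y, (d_mu d mu x y <= (L * d x y)%:E)%E).

Lemma delta_complete : metric_complete d -> forall u : nat -> X,
  (forall e : R, 0 < e -> exists n0, forall m n, (n0 <= m)%N -> (n0 <= n)%N ->
     delta d mu (u m) (u n) <= e) ->
  exists l, forall e : R, 0 < e -> exists n0, forall n, (n0 <= n)%N -> delta d mu (u n) l <= e.
Proof.
move=> cd u cu; have [|l lP] := cd u.
  move=> e e0; have [|n0 n0P] := cu (e / 2); first by rewrite divr_gt0.
  exists n0 => m n mm nn; apply: le_lt_trans (d_le_delta mu_median d_metric dL _ _) _.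
  by apply: le_lt_trans (n0P m n mm nn) _; lra.
exists l => e e0; have L1 : 0 < L + 1 by rewrite ltr_wpDl.
have [|n0 n0P] := lP (e / (L + 1)); first by rewrite divr_gt0.
exists n0 => n /n0P lt; apply: le_trans (delta_le_d dL _ _) _.
have [d0 _ _ _] := d_metric; apply: (@le_trans _ _ ((L + 1) * d (u n) l)).
  by apply: ler_wpM2r => //; rewrite lerDl.
by rewrite mulrC -ler_pdivlMr // ltW.
Qed.

(** The interval is the image of the connected space [X] under [mu z w], and [f] is continuous along
    it, being Lipschitz for [delta] and hence for [d]. *)
Lemma delta_interval_ivt : metric_connected d -> forall f z w (c : R),
  monotone_lipschitz mu (delta d mu) f -> f z <= c <= f w -> exists p, mu z w p = p /\ f p = c.
Proof.
move=> [_ cX] f z w c [_ fl] /andP[zc cw]; apply: contrapT => no.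
have ne p : f (mu z w p) <> c.
  by move=> E; apply: no; exists (mu z w p); split=> //; exact: med_idem.
have [d0 _ dC _] := d_metric.
have step a (e : R) : 0 < e -> exists2 r : R, 0 < r &
    forall b, d a b < r -> `|f (mu z w a) - f (mu z w b)| < e.
  move=> e0; have L1 : 0 < L + 1 by rewrite ltr_wpDl.
  have [|r r0 rP] := mu_cont z w a (e := e / (L + 1)); first by rewrite divr_gt0.
  exists r => // b ab; have dxx x : d x x = 0 by case: d_metric => _ d1 _ _; apply/d1.
  have := rP z w b; rewrite !dxx => /(_ r0 r0 ab) lt.
  apply: (@le_lt_trans _ _ (L * d (mu z w a) (mu z w b))).
    have := fl (mu z w a) (mu z w b); have := fl (mu z w b) (mu z w a).
    have := delta_le_d dL (mu z w a) (mu z w b); have := delta_le_d dL (mu z w b) (mu z w a).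
    by rewrite (dC (mu z w b)) ler_norml => *; apply/andP; split; lra.
  apply: (@le_lt_trans _ _ ((L + 1) * d (mu z w a) (mu z w b))).
    by apply: ler_wpM2r => //; rewrite lerDl.
  by rewrite mulrC -ltr_pdivlMr.
have [||all|none] := cX (fun p => f (mu z w p) < c).
- move=> a ac; have [|r r0 rP] := step a (c - f (mu z w a)); first by rewrite subr_gt0.
  by exists r => // b /rP; rewrite ltr_norml => /andP[]; lra.
- move=> a /negP; rewrite -leNgt le_eqVlt => /orP[/eqP E|ac]; first by case: (ne a).
  have [|r r0 rP] := step a (f (mu z w a) - c); first by rewrite subr_gt0.
  by exists r => // b /rP; rewrite ltr_norml => /andP[? ?] ?; lra.
- by have := all w; rewrite (medyy mu_median) ltNge cw.
- have := none z; have := ne z; rewrite (medxyx mu_median) => nz; apply.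
  by rewrite lt_neqAle zc andbT; apply/eqP.
Qed.

End Continuity.

Theorem theorem3p7 (R : realType) (H : Type) (mul : H -> H -> H) (one : H) (inv : H -> H)
    (X : choiceType) (d : X -> X -> R) (mu : X -> X -> X -> X) (act : H -> X -> X) :
  is_group mul one inv ->
  property_T R mul one inv ->
  metric_median_algebra d mu ->
  uniformly_rectifiable d mu ->
  finite_rank mu ->
  metric_complete d ->
  metric_connected d ->
  isometric_action mul one d mu act ->
  exists x : X, forall g : H, act g x = x.
Proof.
move=> Hgrp HT [mu_median d_metric mu_cont] [L L0 dL] [N rk] cd cX [act1 actM actd actmu].
have [[x0 _] _] := cX; have [mA m1 mV] := Hgrp.
have aut g : automorphism_pair d mu (act g) (act (inv g)).
  by split=> // x; rewrite -actM ?(mV g).1 ?(mV g).2 act1.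
have actD g x y : delta d mu (act g x) (act g y) = delta d mu x y.
  exact: (delta_automorphism mu_median d_metric dL x y (aut g)).
have dC := deltaC mu_median d_metric dL.
have dxx := deltaxx mu_median d_metric dL.
have d0 := delta_ge0 mu_median d_metric dL.
have dT := delta_triangle mu_median d_metric dL.
have dB := delta_btw mu_median d_metric dL.
have dE := delta_eq0 mu_median d_metric dL.
(* The orbit map pulls [delta] back to a left-invariant pseudometric on [H], whose exponential
   kernels stay positive definite. *)
have [C CP] : exists C : R, forall g, delta d mu (act g x0) (act one x0) <= C.
  apply: (@property_T_bounded R H mul one inv Hgrp HT
    (fun g h => delta d mu (act g x0) (act h x0))) => // [k g h|t t0 l].
    by rewrite !actM actD.
  have := delta_kernel_pos_def mu_median d_metric dL t0 [seq (p.1, act p.2 x0) | p <- l].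
  by rewrite /qform big_map; under eq_bigr do rewrite big_map.
have PhiA g f : monotone_lipschitz mu (delta d mu) f ->
    monotone_lipschitz mu (delta d mu) (f \o act g).
  move=> [fm fl]; split=> [u v z _ _ _ E|p q] /=; last by rewrite -(actD g).
  by apply: fm => //; rewrite -actmu E.
have actdinf g x y : dinf mu (delta d mu) (act g x) (act g y) = dinf mu (delta d mu) x y.
  have le h u v : dinf mu (delta d mu) (act h u) (act h v) <= dinf mu (delta d mu) u v.
    by apply: dinf_le => // f /(PhiA h) Pf; exact: dinf_ge Pf.
  apply: le_anti; rewrite le /=; have [gK _ _ _] := aut g.
  by rewrite -{1}(gK x) -{1}(gK y) le.
apply: (@fixed_point R X mu (delta d mu) mu_median d0 dC dE dT dB
  (delta_complete mu_median d_metric L0 dL cd)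
  (delta_interval_ivt mu_median d_metric mu_cont L0 dL cX) N%:R _ _ H act x0 (`|C| + 1)) => //.
- move=> x y; have [f [fm fl fN]] := limit_function mu_median d_metric dL rk x y.
  by apply: le_trans fN _; apply: ler_wpM2l => //; apply: dinf_ge.
- by move=> g; exists (inv g); have [] := aut g.
- by move=> g h; exists (mul g h) => x; rewrite actM.
- move=> g; have := CP g; rewrite act1 dC => le.
  apply: (@le_trans _ _ (delta d mu x0 (act g x0))); first exact: dinf_le_dist.
  by apply: le_trans le _; apply: le_trans (ler_norm C) _; rewrite lerDl.
Qed.
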